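(* Let $\varphi:\Lambda\to\Gamma$ be a regular covering map of finite simplicial graphs such that $\Gamma$ (and hence $\Lambda$) has no isolated vertices. Then the group $\mathrm{LPAut}(\varphi)$ of liftable conjugating automorphisms of $A_\Gamma$ is generated by liftable partial conjugations.
   Context: Graphs are finite simplicial graphs; subgraphs are induced subgraphs. For a graph $\Gamma$, the right-angled Artin group is $A_\Gamma=\langle v\in V\Gamma \mid [u,v]=1 \text{ for every edge } \{u,v\}\rangle$. For a vertex $v$, $\mathrm{lk}(v)$ is the subgraph induced by the vertices adjacent to $v$ and $\mathrm{st}(v)$ the subgraph induced by $\mathrm{lk}(v)\cup\{v\}$. A covering map of graphs $\varphi:\Lambda\to\Gamma$ is a surjective simplicial map which, for every vertex $u$ of $\Lambda$, maps the set of neighbours of $u$ bijectively onto the set of neighbours of $\varphi(u)$. $\mathrm{Deck}(\varphi)$ is the group of graph automorphisms $\mu$ of $\Lambda$ with $\varphi\circ\mu=\varphi$; $\varphi$ is regular if $\mathrm{Deck}(\varphi)$ acts transitively on every fiber $\varphi^{-1}(v)$. The map $\varphi$ induces a surjective homomorphism $\phi:A_\Lambda\to A_\Gamma$, $u\mapsto\varphi(u)$. An automorphism $f$ of $A_\Gamma$ is liftable if there exists $F\in\mathrm{Aut}(A_\Lambda)$ (a lift of $f$) with $f\circ\phi=\phi\circ F$. An automorphism of $A_\Gamma$ is conjugating if it sends each vertex generator $v$ to a conjugate of $v$. For a vertex $v$ and a union $C$ of connected components of $\Gamma\setminus\mathrm{st}(v)$, the partial conjugation $P^v_C$ is the automorphism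 of $A_\Gamma$ sending each vertex $w$ of $C$ to $vwv^{-1}$ and fixing all other vertices. *)

(* Defs.v *)
(* Right-angled Artin groups are modelled concretely:
   elements are words over signed generators, with equality in A_Gamma
   the congruence generated by free cancellation and commutation of
   adjacent generators. *)
From mathcomp Require Import all_boot.
Set Implicit Arguments. Unset Strict Implicit. Unset Printing Implicit Defensive.

Section Graphs.
Variable T : finType.

Definition simple_graph (e : rel T) : Prop := symmetric e /\ irreflexive e.

Definition no_isolated (e : rel T) : Prop := forall v, exists w, e v w.

Definition in_star (e : rel T) (v w : T) : bool := (w == v) || e v w.

Definition union_comp_compl_star (e : rel T) (v : T) (C : {set T}) : Prop :=
  (forall w, w \in C -> ~~ in_star e v w) /\
  (forall w w', w \in C -> ~~ in_star e v w' -> e w w' -> w' \in C).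
End Graphs.

Section Covering.
Variables (W V : finType) (eL : rel W) (eG : rel V).

Definition covering_map (phi : W -> V) : Prop :=
  (forall v, exists u, phi u = v) /\
  (forall u u', eL u u' -> eG (phi u) (phi u')) /\
  (forall u, {in [pred u' | eL u u'] &, injective phi}) /\
  (forall u v, eG (phi u) v -> exists2 u', eL u u' & phi u' = v).

Definition graph_aut (mu : W -> W) : Prop :=
  bijective mu /\ (forall u u', eL (mu u) (mu u') = eL u u').

Definition deck (phi : W -> V) (mu : W -> W) : Prop :=
  graph_aut mu /\ (forall u, phi (mu u) = phi u).

Definition regular_covering (phi : W -> V) : Prop :=
  covering_map phi /\
  (forall u u', phi u = phi u' -> exists2 mu, deck phi mu & mu u = u').
End Covering.

Section RAAG.
Variables (V : finType) (e : rel V).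

(* letter (v, false) is the generator v, (v, true) is v^-1 *)
Definition word := seq (V * bool).

Definition gen (v : V) : word := [:: (v, false)].
Definition inv_word (w : word) : word := rev (map (fun x => (x.1, ~~ x.2)) w).

Inductive raag_rule : word -> word -> Prop :=
  | rule_cancel (v : V) (b : bool) : raag_rule [:: (v, b); (v, ~~ b)] [::]
  | rule_comm (u v : V) (b c : bool) :
      e u v -> raag_rule [:: (u, b); (v, c)] [:: (v, c); (u, b)].

Inductive raag_eq : word -> word -> Prop :=
  | req_step p q s t : raag_rule s t -> raag_eq (p ++ s ++ q) (p ++ t ++ q)
  | req_refl w : raag_eq w w
  | req_sym w1 w2 : raag_eq w1 w2 -> raag_eq w2 w1
  | req_trans w1 w2 w3 : raag_eq w1 w2 -> raag_eq w2 w3 -> raag_eq w1 w3.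
End RAAG.

Definition subst (V V' : finType) (f : V -> word V') (w : word V) : word V' :=
  flatten (map (fun x => if x.2 then inv_word (f x.1) else f x.1) w).

Section Endo.
Variables (V : finType) (e : rel V).

(* f : V -> A_Gamma extends to an endomorphism of A_Gamma *)
Definition is_endo (f : V -> word V) : Prop :=
  forall u v, e u v -> raag_eq e (f u ++ f v) (f v ++ f u).

Definition comp (f g : V -> word V) : V -> word V := fun v => subst f (g v).

Definition idmap : V -> word V := @gen V.

Definition endo_eq (f g : V -> word V) : Prop :=
  forall v, raag_eq e (f v) (g v).

Definition inverse_endo (f g : V -> word V) : Prop :=
  is_endo g /\ endo_eq (comp g f) idmap /\ endo_eq (comp f g) idmap.

Definition is_aut (f : V -> word V) : Prop :=
  is_endo f /\ exists g, inverse_endo f g.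

Definition conjugating (f : V -> word V) : Prop :=
  forall v, exists g : word V, raag_eq e (f v) (g ++ gen v ++ inv_word g).

Definition partial_conj (v : V) (C : {set V}) : V -> word V :=
  fun w => if w \in C then [:: (v, false); (w, false); (v, true)] else gen w.

Definition is_partial_conj (f : V -> word V) : Prop :=
  exists v C, union_comp_compl_star e v C /\ f = partial_conj v C.

Inductive generated (S : (V -> word V) -> Prop) : (V -> word V) -> Prop :=
  | gen_base f : S f -> is_aut f -> generated S f
  | gen_id : generated S idmap
  | gen_comp f g : generated S f -> generated S g -> generated S (comp f g)
  | gen_inv f g : generated S f -> inverse_endo f g -> generated S g
  | gen_eq f g : generated S f -> is_endo g -> endo_eq f g -> generated S g.
End Endo.

Definition map_word (W V : finType) (phi : W -> V) (w : word W) : word V :=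
  map (fun x => (phi x.1, x.2)) w.

Definition liftable (W V : finType) (eL : rel W) (eG : rel V) (phi : W -> V)
    (f : V -> word V) : Prop :=
  exists F : W -> word W, is_aut eL F /\
    forall u, raag_eq eG (f (phi u)) (map_word phi (F u)).

Definition LPAut (W V : finType) (eL : rel W) (eG : rel V) (phi : W -> V)
    (f : V -> word V) : Prop :=
  is_aut eG f /\ conjugating eG f /\ liftable eL eG phi f.

(* Main.v *)
From HB Require Import structures.
From mathcomp Require Import all_boot generic_quotient.
From mathcomp Require Import ssralg ssrnum ssrint zify.
From mathcomp Require Import boolp.
Require Import Defs.

(** Let [kappa] be the cocycle from a right-angled Artin group to its integral
group ring, under conjugation, that sends each generator [s] to [[s]]: the
coefficient [kappa a x] is the signed number of hyperplanes with axis [a]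
crossed on the way from [1] to [x].  Write a conjugating automorphism as
[f v = k_v v k_v^-1] and consider the integers [p v w = kappa (f v) (k_w)] for
[w] outside the star of [v].

If all of them vanish, a ping-pong argument shows that [f] transports [kappa]
to itself, and then [f] is the identity.  Otherwise fix [v] and a sign; the set
[C] of the [w] for which [p v w] has this sign is a union of components of the
complement of the star of [v], and composing [f] with the partial conjugation
of [C] by [v] or its inverse deletes a letter from every [k_w], [w] in [C].

It remains to see that this partial conjugation lifts.  If [F] lifts [f],
[p v (phi u)] is the sum of the limits of [kappa (F b) (F (u^n))] over all [b]
above [v]; every such [b] has a letter [vt] above [v], it commutes with no
generator outside the star of [vt], and therefore its contribution does not
change along paths that avoid this star.  So [p v] takes the same value at the
images of [u] and [u'] as soon as they are connected off the star of each lift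
of [v].  By regularity no lift of [v] separates the others, hence either every
component over [C] or every component over the complement of [C] touches the
link of at most one lift of [v]; conjugating each component by that lift gives
a lift of the partial conjugation, up to an inner automorphism in the second
case. *)

Set Implicit Arguments. Unset Strict Implicit. Unset Printing Implicit Defensive.

Local Open Scope quotient_scope.
Local Open Scope group_scope.

(** * The group of words modulo [raag_eq] *)

Section RaagGroup.
Variables (V : finType) (e : rel V).
Implicit Types w : word V.

Lemma raag_eq_ctx p q w1 w2 :
  raag_eq e w1 w2 -> raag_eq e (p ++ w1 ++ q) (p ++ w2 ++ q).
Proof.
elim=> [p' q' s t st|w|w3 w4 _ IH|w3 w4 w5 _ IH1 _ IH2].
- have assoc (r : word V) : p ++ (p' ++ r ++ q') ++ q = (p ++ p') ++ r ++ (q' ++ q).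
    by rewrite !catA.
  by rewrite !assoc; apply: req_step.
- exact: req_refl.
- exact: req_sym.
- exact: req_trans IH1 IH2.
Qed.

Lemma raag_eq_cat w1 w2 w3 w4 :
  raag_eq e w1 w2 -> raag_eq e w3 w4 -> raag_eq e (w1 ++ w3) (w2 ++ w4).
Proof.
move=> /(raag_eq_ctx [::] w3) h1 /(raag_eq_ctx w2 [::]).
by rewrite !cats0 => h2; apply: req_trans h1 h2.
Qed.

Lemma inv_word_cat w1 w2 : inv_word (w1 ++ w2) = inv_word w2 ++ inv_word w1.
Proof. by rewrite /inv_word map_cat rev_cat. Qed.

End RaagGroup.

Section Quotient.
Variables (V : finType) (e : rel V).

Definition raag_eqb (w1 w2 : word V) : bool := `[< raag_eq e w1 w2 >].

Lemma raag_eqb_refl : reflexive raag_eqb.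
Proof. by move=> w; apply/asboolP; apply: req_refl. Qed.

Lemma raag_eqb_sym : symmetric raag_eqb.
Proof. by move=> w1 w2; apply/idP/idP => /asboolP h; apply/asboolP/req_sym. Qed.

Lemma raag_eqb_trans : transitive raag_eqb.
Proof.
by move=> w2 w1 w3 /asboolP h1 /asboolP h2; apply/asboolP; apply: req_trans h1 h2.
Qed.

Canonical raag_equiv := EquivRel raag_eqb raag_eqb_refl raag_eqb_sym raag_eqb_trans.

Definition raag : Type := {eq_quot raag_equiv}.
HB.instance Definition _ := Choice.on raag.
HB.instance Definition _ := EqQuotient.on raag.

Definition cl (w : word V) : raag := \pi_raag w.

Lemma clP w1 w2 : cl w1 = cl w2 <-> raag_eq e w1 w2.
Proof.
split; first by move/eqquotP/asboolP.
by move=> h; apply/eqquotP/asboolP.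
Qed.

Lemma cl_repr (x : raag) : cl (repr x) = x.
Proof. exact: reprK. Qed.

Lemma clW (P : raag -> Prop) : (forall w, P (cl w)) -> forall x, P x.
Proof. by move=> h x; rewrite -(cl_repr x). Qed.

Definition raag_mul (x y : raag) : raag := cl (repr x ++ repr y).

Lemma raag_mulE w1 w2 : raag_mul (cl w1) (cl w2) = cl (w1 ++ w2).
Proof. by apply/clP; apply: raag_eq_cat; apply/clP; rewrite cl_repr. Qed.

Lemma cancel_right w : cl (w ++ inv_word w) = cl [::].
Proof.
apply/clP; elim/last_ind: w => [|w [v b] IH]; first exact: req_refl.
rewrite -cats1 inv_word_cat /= -catA.
apply: req_trans IH; rewrite /inv_word /rev /=.
have := @req_step V e w (inv_word w) _ _ (rule_cancel e v b).
by rewrite /= /inv_word /rev.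
Qed.

Lemma inv_wordK : involutive (@inv_word V).
Proof.
move=> w; rewrite /inv_word map_rev revK -map_comp map_id_in // => -[v b] _ /=.
by rewrite negbK.
Qed.

Definition raag_inv (x : raag) : raag := cl (inv_word (repr x)).

Lemma raag_mulA : associative raag_mul.
Proof.
by elim/clW=> x; elim/clW=> y; elim/clW=> z; rewrite !raag_mulE catA.
Qed.

Lemma raag_mul1 : left_id (cl [::]) raag_mul.
Proof. by elim/clW=> x; rewrite raag_mulE. Qed.

Lemma raag_mulr1 : right_id (cl [::]) raag_mul.
Proof. by elim/clW=> x; rewrite raag_mulE cats0. Qed.

Lemma raag_mulVr : right_inverse (cl [::]) raag_inv raag_mul.
Proof.
by move=> x; rewrite /raag_inv -{1}(cl_repr x) raag_mulE cancel_right.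
Qed.

Lemma raag_mulV : left_inverse (cl [::]) raag_inv raag_mul.
Proof.
move=> x; rewrite /raag_inv -{2}(cl_repr x) raag_mulE.
by rewrite -{2}(inv_wordK (repr x)) cancel_right.
Qed.

HB.instance Definition _ :=
  isGroup.Build raag raag_mulA raag_mul1 raag_mulr1 raag_mulV raag_mulVr.

Definition gn (v : V) : raag := cl (gen v).

Lemma cl_nil : cl [::] = 1. Proof. by []. Qed.
Lemma cl_cat w1 w2 : cl (w1 ++ w2) = cl w1 * cl w2.
Proof. by rewrite -raag_mulE. Qed.
Lemma cl_inv w : cl (inv_word w) = (cl w)^-1.
Proof.
apply: (@mulgI _ (cl w)); rewrite mulgV -cl_cat; exact: cancel_right.
Qed.

Definition letter (x : V * bool) : raag := if x.2 then (gn x.1)^-1 else gn x.1.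

Lemma cl_cons x w : cl (x :: w) = letter x * cl w.
Proof.
rewrite -cat1s cl_cat; congr (_ * _); case: x => v [] //=.
by rewrite /letter -cl_inv.
Qed.

Lemma gn_commute u v : e u v -> commute (gn u) (gn v).
Proof.
move=> euv; rewrite /commute -!cl_cat; apply/clP.
exact: (@req_step _ e [::] [::] _ _ (rule_comm false false euv)).
Qed.

Lemma letterN v b : letter (v, ~~ b) = (letter (v, b))^-1.
Proof. by case: b; rewrite /letter /= ?invgK. Qed.
End Quotient.

(** * Homomorphisms out of a right-angled Artin group *)

Section Universal.
Variables (V : finType) (e : rel V) (H : groupType) (h : V -> H).

Definition evw (w : word V) : H :=
  foldr (fun x y => (if x.2 then (h x.1)^-1 else h x.1) * y) 1 w.

Lemma evw_cat w1 w2 : evw (w1 ++ w2) = evw w1 * evw w2.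
Proof. by elim: w1 => [|x w IH] /=; rewrite ?mul1g // IH mulgA. Qed.

Hypothesis hC : forall u v, e u v -> commute (h u) (h v).

Lemma evw_raag_eq w1 w2 : raag_eq e w1 w2 -> evw w1 = evw w2.
Proof.
elim=> [p q s t st|w|w3 w4 _ IH|w3 w4 w5 _ -> _ ->] //.
rewrite !evw_cat; congr (_ * (_ * _)); case: st => [v b|u v b c euv] /=.
  by case: b => /=; rewrite mulg1 ?mulgV ?mulVg.
rewrite !mulg1 -!/(commute _ _).
have huv := hC euv.
by case: b c => -[]; do ?[exact: huv | apply: commuteV | apply: commute_sym].
Qed.

(** Evaluating a representative keeps [ev] total, with no proof argument; under [hC] it is a
    homomorphism. *)
Definition ev (x : raag e) : H := evw (repr x).

Lemma ev_cl w : ev (cl e w) = evw w.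
Proof. by apply: evw_raag_eq; apply/clP; rewrite cl_repr. Qed.

Lemma evM : {morph ev : x y / x * y}.
Proof.
by elim/clW=> x; elim/clW=> y; rewrite -cl_cat !ev_cl evw_cat.
Qed.

Lemma ev_gn v : ev (gn e v) = h v.
Proof. by rewrite ev_cl /= mulg1. Qed.
End Universal.

Section Morphisms.
Variables (G H : groupType) (f : G -> H).
Hypothesis fM : {morph f : x y / x * y}.

Lemma morph1 : f 1 = 1.
Proof. by apply: (@mulgI _ (f 1)); rewrite -fM !mulg1. Qed.
Lemma morphV x : f x^-1 = (f x)^-1.
Proof. by apply: (@mulgI _ (f x)); rewrite -fM !mulgV morph1. Qed.
Lemma morphJ x y : f (x ^ y) = f x ^ f y.
Proof. by rewrite !conjgE !fM morphV. Qed.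
Lemma morphX x n : f (x ^+ n) = f x ^+ n.
Proof. by elim: n => [|n IH]; rewrite ?morph1 // !expgS fM IH. Qed.
End Morphisms.

Lemma morph_ext (V : finType) (e : rel V) (H : groupType) (f g : raag e -> H) :
  {morph f : x y / x * y} -> {morph g : x y / x * y} ->
  (forall v, f (gn e v) = g (gn e v)) -> f =1 g.
Proof.
move=> fM gM fg; elim/clW; elim=> [|[v b] w IH].
  by rewrite cl_nil !morph1.
by rewrite cl_cons fM gM IH; case: b; rewrite /letter /= ?morphV // fg.
Qed.

(** * Crossings *)

Definition sgn (b : bool) : int := if b then (-1)%R else 1%R.

Section Crossings.
Variables (V : finType) (e : rel V).
Local Notation G := (raag e).
Implicit Types (w : word V) (Q : V -> G -> bool) (P : pred G) (x y a : G).

Definition shift x (c : V * G * bool) : V * G * bool := (c.1.1, x * c.1.2, c.2).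

(** The group element recorded is the endpoint [g] of the crossed edge from [g] to [g s]; for an
    inverse letter this is the endpoint reached, not the one left. *)
Fixpoint crossings w : seq (V * G * bool) :=
  if w is (s, b) :: w' then
    (s, if b then (gn e s)^-1 else 1, b) :: map (shift (letter e (s, b))) (crossings w')
  else [::].

Lemma crossings_cat w1 w2 :
  crossings (w1 ++ w2) = crossings w1 ++ map (shift (cl e w1)) (crossings w2).
Proof.
elim: w1 => [|[s b] w IH] /=.
  rewrite -[LHS]map_id; apply: eq_map => -[[s g] b].
  by rewrite /shift /= cl_nil mul1g.
rewrite IH map_cat -map_comp; congr (_ :: (_ ++ _)).
by apply: eq_map => c; rewrite /shift /= cl_cons mulgA.
Qed.

Lemma size_crossings w : size (crossings w) = size w.
Proof. by elim: w => [|[s b] w IH] //=; rewrite size_map IH. Qed.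

Definition cntw Q w : int := (\sum_(c <- crossings w | Q c.1.1 c.1.2) sgn c.2)%R.

Lemma cntw_cat Q w1 w2 :
  cntw Q (w1 ++ w2) = (cntw Q w1 + cntw (fun s g => Q s (cl e w1 * g)%g) w2)%R.
Proof. by rewrite /cntw crossings_cat big_cat big_map. Qed.

(* [(s, g)] stands for the hyperplane dual to the edge from [g] to [g s]; it is
   also dual to the edges from [g t] to [g t s] for [t] in the link of [s]. *)
Definition link_invariant Q := forall s t g, e s t -> Q s (g * gn e t) = Q s g.

Lemma link_invariant_shift Q x :
  link_invariant Q -> link_invariant (fun s g => Q s (x * g)).
Proof. by move=> iQ s t g st; rewrite mulgA iQ. Qed.

Lemma link_invariant_letter Q s t b g :
  link_invariant Q -> e s t -> Q s (g * letter e (t, b)) = Q s g.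
Proof.
move=> iQ st; case: b; rewrite /letter /= ?iQ //.
by rewrite -(iQ _ t) // mulgVK.
Qed.

Lemma cntw1 Q s b :
  cntw Q [:: (s, b)] = (if Q s (if b then (gn e s)^-1 else 1) then sgn b else 0%R).
Proof. by rewrite /cntw /= big_mkcond big_seq1. Qed.

Hypothesis symE : symmetric e.

(** A cancelling pair crosses one edge in both directions. The two ways round a commutation square
    cross parallel edges, on which [Q] agrees by link invariance. *)
Lemma cntw_raag_eq Q w1 w2 :
  link_invariant Q -> raag_eq e w1 w2 -> cntw Q w1 = cntw Q w2.
Proof.
move=> iQ E; elim: E Q iQ => [p q s t st Q iQ|w|w3 w4 _ IH|w3 w4 w5 _ IH1 _ IH2] //.
- have eqst : cl e s = cl e t.
    by apply/clP; have := @req_step _ e [::] [::] _ _ st; rewrite !cats0.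
  rewrite !cntw_cat eqst; congr (_ + (_ + _))%R.
  have {}iQ := link_invariant_shift (cl e p) iQ.
  move: (fun _ => _) iQ => {}Q iQ; case: st => [v b|u v b c euv].
    rewrite -(cat1s (v, b)) cntw_cat !cntw1 /cntw big_nil cl_cons cl_nil mulg1.
    by case: b; rewrite /letter /= ?mulgV ?mulg1; case: (Q _ _).
  rewrite -(cat1s (u, b)) -(cat1s (v, c) [:: (u, b)]) !cntw_cat !cntw1.
  rewrite !cl_cons !cl_nil !mulg1.
  have comm u' v' b1 b2 : e u' v' ->
      Q v' (letter e (u', b1) * (if b2 then (gn e v')^-1 else 1)) =
      Q v' (if b2 then (gn e v')^-1 else 1).
    move=> st; rewrite -[RHS](@link_invariant_letter Q v' u' b1) // 1?symE //.
    congr (Q v' _); have C := gn_commute st.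
    case: b1 b2 => -[]; rewrite /letter /= ?mulg1 ?mul1g //.
      by apply: commuteV; apply: commute_sym; apply: commuteV; apply: commute_sym.
    by apply: commuteV.
  by rewrite !comm // 1?symE //; exact: GRing.addrC.
- by move=> Q iQ; rewrite IH.
- by move=> Q iQ; rewrite IH1 // IH2.
Qed.

Definition cnt Q x : int := cntw Q (repr x).

Lemma cnt_cl Q w : link_invariant Q -> cnt Q (cl e w) = cntw Q w.
Proof. by move=> iQ; apply: cntw_raag_eq => //; apply/clP; rewrite cl_repr. Qed.

Lemma cntM Q x y : link_invariant Q ->
  cnt Q (x * y) = (cnt Q x + cnt (fun s g => Q s (x * g)%g) y)%R.
Proof.
move=> iQ; elim/clW: x; elim/clW: y => y x; rewrite -cl_cat !cnt_cl //.
  exact: cntw_cat.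
exact: link_invariant_shift.
Qed.

Lemma cnt_ext Q Q' : (forall s g, Q s g = Q' s g) -> cnt Q =1 cnt Q'.
Proof. by move=> QQ' x; rewrite /cnt /cntw; apply: eq_bigl => c. Qed.

Definition expo (v : V) x : int := cnt (fun s _ => s == v) x.

Lemma expoM v x y : expo v (x * y) = (expo v x + expo v y)%R.
Proof. exact: cntM. Qed.

Lemma expo1 v : expo v 1 = 0%R.
Proof. by rewrite -cl_nil /expo cnt_cl // /cntw big_nil. Qed.

Lemma expoV v x : expo v x^-1 = (- expo v x)%R.
Proof. have := expoM v x x^-1; rewrite mulgV expo1; lia. Qed.

Lemma expo_gn v s : expo v (gn e s) = Posz (s == v).
Proof. by rewrite /expo /gn cnt_cl // /gen cntw1; case: eqP. Qed.

Lemma expoJ v x y : expo v (x ^ y) = expo v x.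
Proof. rewrite conjgE !expoM expoV; lia. Qed.

Lemma expoX v x n : expo v (x ^+ n) = (expo v x * Posz n)%R.
Proof. by elim: n => [|n IH]; rewrite ?expo1 ?expgS ?expoM ?IH; lia. Qed.

Lemma expo_cl_neq0 v w : expo v (cl e w) != 0%R -> v \in map fst w.
Proof.
elim: w => [|[s b] w IH]; first by rewrite cl_nil expo1.
rewrite cl_cons expoM inE; case: (v =P s) => //= ne h; apply: IH; move: h.
have -> : expo v (letter e (s, b)) = 0%R.
  by case: b; rewrite /letter /= ?expoV expo_gn; case: eqP ne => // -> [].
by rewrite GRing.add0r.
Qed.

Lemma gnJ_inj s t x y : gn e s ^ x = gn e t ^ y -> s = t.
Proof.
move/(congr1 (expo t)); rewrite !expoJ !expo_gn eqxx.
by case: eqP.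
Qed.

(* The conjugate of a generator that translates along the crossed hyperplane. *)
Definition axis (c : V * G * bool) : G := gn e c.1.1 ^ c.1.2^-1.

Definition axes w : seq G := map axis (crossings w).

Definition kap P x : int := cnt (fun s g => P (gn e s ^ g^-1)) x.

Lemma kap_inv P : link_invariant (fun s g => P (gn e s ^ g^-1)).
Proof.
move=> s t g st /=; congr (P _); rewrite invgM conjgM; congr (_ ^ _).
by apply/conjg_fixP/commgP; apply/commuteV/gn_commute.
Qed.

Lemma kap_cl P w :
  kap P (cl e w) = (\sum_(c <- crossings w | P (axis c)) sgn c.2)%R.
Proof. by rewrite /kap cnt_cl //; exact: kap_inv. Qed.

Lemma kapM P x y : kap P (x * y) = (kap P x + kap (fun a => P (a ^ x^-1)%g) y)%R.
Proof.
rewrite /kap cntM; last exact: kap_inv.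
by congr (_ + _)%R; apply: cnt_ext => s g; rewrite invgM conjgM.
Qed.

Lemma kap_ext P P' : P =1 P' -> kap P =1 kap P'.
Proof. by move=> h; apply: cnt_ext => s g; rewrite h. Qed.

Definition kappa a x : int := kap (pred1 a) x.

(** The cocycle identity: left translation by [x] carries the axis [a ^ x] to [a]. *)
Lemma kappaM a x y : kappa a (x * y) = (kappa a x + kappa (a ^ x)%g y)%R.
Proof.
rewrite /kappa kapM; congr (_ + _)%R; apply: kap_ext => b /=.
by rewrite -(inj_eq (@conjg_inj _ x)) conjgKV.
Qed.

Lemma kappa1 a : kappa a 1 = 0%R.
Proof. by rewrite -cl_nil /kappa kap_cl big_nil. Qed.

Lemma kappaV a x : kappa a x^-1 = (- kappa (a ^ x^-1)%g x)%R.
Proof. have := kappaM a x^-1 x; rewrite mulVg kappa1; lia. Qed.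

Lemma kappa_gn a s : kappa a (gn e s) = Posz (gn e s == a).
Proof.
rewrite /kappa /gn kap_cl /= big_mkcond big_seq1 /axis /= invg1 conjg1.
by rewrite /gn /=; case: eqP.
Qed.

Lemma kappa_letter a s b :
  kappa a (letter e (s, b)) = (if gn e s == a then sgn b else 0%R).
Proof.
case: b; rewrite /letter /= ?kappaV kappa_gn; last by case: eqP.
rewrite -(inj_eq (@conjg_inj _ (gn e s))) conjgKV.
have -> : gn e s ^ gn e s = gn e s by apply/conjg_fixP/commgP.
by case: eqP.
Qed.

Lemma kap_neq0_has P w : kap P (cl e w) != 0%R -> has P (axes w).
Proof.
rewrite kap_cl; apply: contraR => /hasPn h.
rewrite big_seq_cond big1 // => c /andP [cw]; apply: contraTeq => _.
by apply: h; apply: map_f.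
Qed.

Lemma kappa_neq0 a w : kappa a (cl e w) != 0%R -> a \in axes w.
Proof. by move/kap_neq0_has/hasP => [b hb /eqP <-]. Qed.

Lemma crossingP w c : c \in crossings w ->
  exists w1 w2, w = w1 ++ (c.1.1, c.2) :: w2 /\ axis c = gn e c.1.1 ^ (cl e w1)^-1.
Proof.
elim: w c => // -[s b] w IH c; rewrite inE => /orP [/eqP ->|/mapP [c' /IH [w1 [w2 [-> h]]] ->]].
  exists [::], w; split=> //; rewrite /axis /= cl_nil invg1 conjg1; case: b => //=.
    by rewrite invgK; apply/conjg_fixP/commgP.
  by rewrite invg1 conjg1.
exists ((s, b) :: w1), w2; split=> //.
by rewrite /axis /shift /= invgM conjgM -/(axis c') h cl_cons invgM conjgM.
Qed.

(** * Words of minimal length *)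

Definition minimal w := forall w', cl e w' = cl e w -> size w <= size w'.

Lemma minimal_exists x : exists2 w, minimal w & cl e w = x.
Proof.
have ex : exists n, `[< exists2 w, cl e w = x & size w = n >].
  by exists (size (repr x)); apply/asboolP; exists (repr x); rewrite ?cl_repr.
case: (ex_minnP ex) => n /asboolP [w wx sw] mn; exists w => // w' w'w.
by rewrite sw; apply: mn; apply/asboolP; exists w'; rewrite ?w'w.
Qed.

Lemma minimal_behead (l : V * bool) w : minimal (l :: w) -> minimal w.
Proof.
move=> m w' h; have := m (l :: w'); rewrite !cl_cons h => /(_ erefl).
by rewrite /= ltnS.
Qed.

(** If both letters lay on one axis, [s] would commute with [w2], and deleting the two letters would
    give a shorter word for the same element. *)
Lemma minimal_no_cancel w1 w2 w3 s t b :
  minimal (w1 ++ (s, b) :: w2 ++ (t, ~~ b) :: w3) ->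
  gn e s ^ (cl e w1)^-1 != gn e t ^ (cl e (w1 ++ (s, b) :: w2))^-1.
Proof.
move=> m; apply/eqP => E; have st := gnJ_inj E; subst t.
have C : commute (gn e s) (cl e w2).
  apply/commgP/conjg_fixP; move: E; rewrite cl_cat cl_cons !invgM !conjgM.
  move/conjg_inj/(congr1 (fun z => z ^ letter e (s, b))); rewrite conjgKV.
  have -> : gn e s ^ letter e (s, b) = gn e s.
    by apply/conjg_fixP/commgP; case: b {m} => //; apply: commuteV.
  by move=> h; rewrite {1}h conjgKV.
have {}C : commute (letter e (s, b)) (cl e w2).
  by case: b {m E} => //; apply/commute_sym/commuteV/commute_sym.
have := m (w1 ++ w2 ++ w3); rewrite !cl_cat !cl_cons !cl_cat !cl_cons letterN.
rewrite [letter e (s, b) * _]mulgA C -!mulgA mulVKg => /(_ erefl).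
rewrite !size_cat /= size_cat /=; lia.
Qed.

Lemma minimal_sign w c d : minimal w -> c \in crossings w -> d \in crossings w ->
  axis c = axis d -> c.2 = d.2.
Proof.
move=> m cw dw cd; apply/eqP; apply: contraTT isT => ne.
have [w1 [w2 [Ew axc]]] := crossingP cw.
move: dw; rewrite Ew crossings_cat mem_cat => /orP [dw|].
  have [w3 [w4 [Ew1 axd]]] := crossingP dw.
  have Eb : ~~ d.2 = c.2 by move: ne; case: (c.2) (d.2) => -[].
  have := @minimal_no_cancel w3 w4 w2 d.1.1 c.1.1 d.2.
  rewrite Eb -axd -cd axc Ew1 eqxx; apply.
  by move: m; rewrite Ew Ew1 -catA.
rewrite [map _ _]/=; rewrite inE => /orP [/eqP dE|].
  by move: ne; rewrite dE /= eqxx.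
rewrite -map_comp => /mapP [d' d'w2 dE].
have [w3 [w4 [Ew2 axd]]] := crossingP d'w2.
have Eb : ~~ c.2 = d.2 by move: ne; case: (c.2) (d.2) => -[].
have := @minimal_no_cancel w1 w3 w4 c.1.1 d.1.1 c.2.
have -> : gn e d.1.1 ^ (cl e (w1 ++ (c.1.1, c.2) :: w3))^-1 = axis c.
  rewrite cd dE /axis /= !invgM !conjgM -/(axis d') axd cl_cat cl_cons.
  by rewrite !invgM !conjgM.
rewrite Eb -axc eqxx; apply.
by move: m; rewrite Ew Ew2 dE.
Qed.

Lemma minimal_cntw Q w c : minimal w -> c \in crossings w -> Q c.1.1 c.1.2 ->
  (forall d, d \in crossings w -> Q d.1.1 d.1.2 -> axis d = axis c) ->
  cntw Q w = (sgn c.2 * Posz (count (fun d => Q d.1.1 d.1.2) (crossings w)))%R.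
Proof.
move=> m cw Qc same; rewrite /cntw.
have : forall d, d \in crossings w -> Q d.1.1 d.1.2 -> d.2 = c.2.
  by move=> d dw /(same d dw) /(minimal_sign m dw cw).
elim: (crossings w) => [|d r IH] h; first by rewrite big_nil; case: (c.2).
rewrite big_cons /= IH; last by move=> d' d'r; apply: h; rewrite inE d'r orbT.
case Qd: (Q d.1.1 d.1.2); rewrite ?add0n //.
by rewrite (h d (mem_head _ _) Qd) /sgn; case: (c.2); lia.
Qed.

Lemma minimal_cntw_neq0 Q w c : minimal w -> c \in crossings w -> Q c.1.1 c.1.2 ->
  (forall d, d \in crossings w -> Q d.1.1 d.1.2 -> axis d = axis c) ->
  cntw Q w != 0%R.
Proof.
move=> m cw Qc same; rewrite (minimal_cntw m cw Qc same).
have : 0 < count (fun d => Q d.1.1 d.1.2) (crossings w).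
  by rewrite -has_count; apply/hasP; exists c.
by rewrite /sgn; case: (c.2); lia.
Qed.

Lemma minimal_kappa_neq0 w c : minimal w -> c \in crossings w ->
  kappa (axis c) (cl e w) != 0%R.
Proof.
move=> m cw; rewrite /kappa /kap cnt_cl; last exact: kap_inv.
by apply: (minimal_cntw_neq0 m cw) => //= d _ /eqP.
Qed.
End Crossings.

(** * Centralizers *)

(** Each of the finitely many entries excludes at most one index. This is how counts along powers
    are shown to stabilize. *)
Lemma eventually_not (T : eqType) (s : seq T) (P : nat -> T -> Prop) :
  (forall x n m, P n x -> P m x -> n = m) ->
  exists N, forall n, N <= n -> forall x, x \in s -> ~ P n x.
Proof.
move=> inj; elim: s => [|y s [N IH]]; first by exists 0.
have [[k Pk]|nP] := pselect (exists k, P k y).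
  exists (maxn N k.+1) => n le x; rewrite inE => /orP [/eqP ->|xs].
    by move=> Pn; have := inj _ _ _ Pk Pn; lia.
  by apply: IH => //; lia.
exists N => n le x; rewrite inE => /orP [/eqP -> Pn|xs]; last exact: IH.
by apply: nP; exists n.
Qed.

Section Centralizers.
Variables (V : finType) (e : rel V).
Hypotheses (symE : symmetric e) (irrE : irreflexive e).
Local Notation G := (raag e).
Implicit Types (w : word V) (x y a g h : G) (s t v z : V).

Lemma in_star_sym s t : in_star e s t = in_star e t s.
Proof. by rewrite /in_star eq_sym symE. Qed.

(** The retraction onto the subgroup generated by the link of [s]; membership in this subgroup
    becomes the decidable condition of being fixed. *)
Definition link_proj s : G -> G := @ev V e G (fun t => if e s t then gn e t else 1).
Definition in_link s g := link_proj s g == g.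

Lemma link_proj_comm s u v : e u v ->
  commute (if e s u then gn e u else 1) (if e s v then gn e v else 1).
Proof.
move=> /gn_commute C; case: (e s u); case: (e s v) => //; rewrite /commute ?mul1g ?mulg1 //.
Qed.

Lemma link_projM s : {morph link_proj s : x y / x * y}.
Proof. exact: evM (@link_proj_comm s). Qed.

Lemma link_proj_gn s t : link_proj s (gn e t) = if e s t then gn e t else 1.
Proof. exact: ev_gn (@link_proj_comm s) _. Qed.

Lemma link_proj_ind (P : G -> Prop) s :
  P 1 -> (forall x y, P x -> P y -> P (x * y)) -> (forall x, P x -> P x^-1) ->
  (forall t, e s t -> P (gn e t)) -> forall g, P (link_proj s g).
Proof.
move=> P1 PM PV Pg; elim/clW; elim=> [|[t b] w IH].
  by rewrite cl_nil (morph1 (link_projM s)).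
rewrite cl_cons link_projM; apply: PM => //.
have Pt : P (link_proj s (gn e t)) by rewrite link_proj_gn; case: ifP => // /Pg.
by case: b; rewrite /letter //= (morphV (link_projM s)); apply: PV.
Qed.

Lemma in_link_commute s g : in_link s g -> commute (gn e s) g.
Proof.
move=> /eqP <-; apply: (@link_proj_ind (commute (gn e s)) s).
- exact: commute1.
- by move=> x y; apply: commuteM.
- by move=> x; apply: commuteV.
- by move=> t /gn_commute.
Qed.

Lemma in_link_expo s z g : ~~ e s z -> in_link s g -> expo z g = 0%R.
Proof.
move=> sz /eqP <-; apply: (@link_proj_ind (fun y => expo z y = 0%R) s).
- exact: expo1.
- by move=> x y h1 h2; rewrite (expoM symE) h1 h2.
- by move=> x h; rewrite (expoV symE) h.
- by move=> t st; rewrite (expo_gn symE); case: eqP st sz => // -> ->.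
Qed.

(** A single hyperplane, the one dual to the edge from [h] to [h s], whereas an axis is shared by
    all its translates along [s]. *)
Definition hyper s h t g := (t == s) && in_link s (h^-1 * g).

Lemma hyper_inv s h : link_invariant (hyper s h).
Proof.
move=> t u g tu; rewrite /hyper; case: eqP tu => //= -> su.
rewrite /in_link mulgA link_projM link_proj_gn su.
by rewrite (inj_eq (@mulIg _ _)).
Qed.

Lemma hyper_axis s h c : hyper s h c.1.1 c.1.2 -> axis c = gn e s ^ h^-1.
Proof.
case/andP => /eqP E /in_link_commute /commgP/conjg_fixP F.
apply: (@conjg_inj _ c.1.2); rewrite /axis conjgKV -conjgM E.
by rewrite F.
Qed.

Lemma cntw_no_letter (Q : V -> G -> bool) w :
  (forall s g, s \in map fst w -> ~~ Q s g) -> cntw Q w = 0%R.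
Proof.
move=> h; rewrite /cntw big_seq_cond big1 // => c /andP [cw Qc].
have [w1 [w2 [E _]]] := crossingP cw.
by move: Qc; apply: contraTeq => _; apply: h; rewrite E map_cat mem_cat /= inE eqxx orbT.
Qed.

Lemma letter_crossing w t : t \in map fst w -> exists2 c, c \in crossings e w & c.1.1 = t.
Proof.
elim: w => // -[s b] w IH; rewrite inE => /orP [/eqP ->|/IH [c cw <-]].
  by eexists; first exact: mem_head.
by exists (shift (letter e (s, b)) c) => //; rewrite inE map_f // orbT.
Qed.

(** Suppose [w] has a letter [t] outside the star of [z]. As [c] crosses no hyperplane labelled [t],
    comparing the paths [c w] and [w c] shows that [w] crosses equally often all translates of one
    such hyperplane by powers of [c]. The exponent of [z] tells these translates apart, which is
    absurd for a finite word. *)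
Lemma centralizer_letters z cw w : all (in_star e z) (map fst cw) ->
  expo z (cl e cw) != 0%R -> commute (cl e cw) (cl e w) -> minimal e w ->
  all (in_star e z) (map fst w).
Proof.
set c := cl e cw => cwz cz comm m; apply/allP => t tw; apply: contraT => nzt.
have ntz : ~~ e t z by move: nzt; rewrite /in_star negb_or symE => /andP [].
have [d dw dt] := letter_crossing tw; pose h := d.1.2.
have c0 h1 x : cnt (fun s g => hyper t h1 s (x * g)) c = 0%R.
  rewrite cnt_cl //; last exact: link_invariant_shift (@hyper_inv _ _).
  apply: cntw_no_letter => s g scw; rewrite /hyper.
  by case: eqP => // st; move/allP: cwz => /(_ s scw); rewrite st (negbTE nzt).
have step h1 : cnt (hyper t (c * h1)) (cl e w) = cnt (hyper t h1) (cl e w).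
  have iQ := @hyper_inv t (c * h1).
  have := cntM symE (cl e w) c iQ; rewrite c0 GRing.addr0 -comm => <-.
  rewrite (cntM symE _ _ iQ).
  have -> : cnt (hyper t (c * h1)) c = 0%R.
    by rewrite -[RHS](c0 (c * h1) 1); apply: cnt_ext => s g; rewrite mul1g.
  rewrite GRing.add0r; apply: cnt_ext => s g.
  by rewrite /hyper invgM -mulgA mulKg.
have steps n : cnt (hyper t (c ^+ n * h)) (cl e w) = cnt (hyper t h) (cl e w).
  by elim: n => [|n IH]; rewrite ?mul1g // expgS -mulgA step.
have nz : cnt (hyper t h) (cl e w) != 0%R.
  rewrite cnt_cl //; last exact: hyper_inv.
  apply: (minimal_cntw_neq0 symE m dw).
    rewrite /hyper dt eqxx /in_link mulVg /=; apply/eqP; exact: morph1 (link_projM t).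
  by move=> d' _ /hyper_axis ->; rewrite /axis dt.
have [|N HN] := @eventually_not _ (crossings e w)
    (fun n d => hyper t (c ^+ n * h) d.1.1 d.1.2).
  move=> d' n k /andP [_ /(in_link_expo ntz) E1] /andP [_ /(in_link_expo ntz) E2].
  move: E1 E2; rewrite !(expoM symE) !(expoV symE) !(expoM symE) !(expoX symE).
  move=> E1 E2; have : (expo z c * Posz n = expo z c * Posz k)%R by lia.
  by move/(GRing.mulfI cz) => [].
move: nz; rewrite -(steps N) cnt_cl //; last exact: hyper_inv.
rewrite /cntw big_seq_cond big1 ?eqxx // => d' /andP [d'w].
by move/(HN N (leqnn N) d' d'w).
Qed.

Lemma star_letters_commute z w :
  all (in_star e z) (map fst w) -> commute (gn e z) (cl e w).
Proof.
elim: w => [_|[t b] w IH /= /andP [zt /IH C]]; first exact: commute1.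
rewrite cl_cons; apply: commuteM => //.
have {}zt : commute (gn e z) (gn e t).
  by case/orP: zt => [/eqP -> //|/gn_commute].
by case: b; rewrite /letter //=; apply: commuteV.
Qed.

Lemma cl_nseq v b n : cl e (nseq n (v, b)) = letter e (v, b) ^+ n.
Proof. by elim: n => [|n IH] //=; rewrite cl_cons IH expgS. Qed.

(** If [n] and [m] differ, [a] commutes with a word in [z] and [z'] whose exponent of [z] is
    [n - m], so [centralizer_letters] puts the letters of [a] in the star of [z]. *)
Lemma conj_powers_inj z z' a n m j k : e z z' -> ~ commute (gn e z) a ->
  a ^ (gn e z ^+ n * gn e z' ^+ j) = a ^ (gn e z ^+ m * gn e z' ^+ k) -> n = m.
Proof.
move=> zz' nC E; apply/eqP; apply: contraT => nm; case: nC.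
have [w mw wa] := minimal_exists a; rewrite -wa; apply: star_letters_commute.
pose cw := nseq n (z, false) ++ nseq j (z', false) ++ nseq k (z', true) ++ nseq m (z, true).
have Ecw : cl e cw = (gn e z ^+ n * gn e z' ^+ j) * (gn e z ^+ m * gn e z' ^+ k)^-1.
  by rewrite /cw !cl_cat !cl_nseq /letter /= !expVgn invgM !mulgA.
apply: (@centralizer_letters z cw) => //.
- rewrite !map_cat !all_cat !map_nseq !all_nseq /in_star /= !eqxx zz' !orbT.
  by [].
- rewrite Ecw !(expoM symE) (expoV symE) !(expoM symE) !(expoX symE) !(expo_gn symE).
  by rewrite eqxx; case: (z' =P z) zz' => [->|_ _]; rewrite ?irrE //; lia.
- rewrite Ecw wa; apply/commute_sym/commgP/conjg_fixP.
  by rewrite conjgM E conjgK.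
Qed.

Lemma gn_commute_star z v : commute (gn e z) (gn e v) -> in_star e z v.
Proof.
move=> C; have [w mw wv] := minimal_exists (gn e v).
have /allP st : all (in_star e z) (map fst w).
  apply: (@centralizer_letters z (gen z)) mw; rewrite ?wv //=.
    by rewrite /in_star eqxx.
  by rewrite -/(gn e z) (expo_gn symE) eqxx.
by apply/st/(expo_cl_neq0 symE); rewrite wv (expo_gn symE) eqxx.
Qed.

Lemma conj_gn_powers_inj (w v : V) n m : ~~ in_star e w v ->
  gn e v ^ (gn e w ^+ n) = gn e v ^ (gn e w ^+ m) -> n = m.
Proof.
move=> nwv E; apply/eqP; apply: contraT => nm; case/negP: nwv.
have [u mu uv] := minimal_exists (gn e v).
pose cw := nseq n (w, false) ++ nseq m (w, true).
have Ecw : cl e cw = gn e w ^+ n * (gn e w ^+ m)^-1.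
  by rewrite /cw !cl_cat !cl_nseq /letter /= !expVgn.
have /allP st : all (in_star e w) (map fst u).
  apply: (@centralizer_letters w cw) mu.
  - by rewrite !map_cat !all_cat !map_nseq !all_nseq /in_star /= !eqxx !orbT.
  - rewrite Ecw !(expoM symE) (expoV symE) !(expoX symE) !(expo_gn symE).
    by rewrite eqxx; lia.
  - rewrite Ecw uv; apply/commute_sym/commgP/conjg_fixP.
    by rewrite conjgM E conjgK.
by apply/st/(expo_cl_neq0 symE); rewrite uv (expo_gn symE) eqxx.
Qed.

Section TwoAxes.
Variables (s : V) (a b : G).
Hypothesis nC : ~ commute (gn e s ^ a^-1) b.

(* The set of [g] with [gn e s ^ g^-1] equal to a given element is a coset of
   the subgroup generated by the star of [s]. *)
Lemma kappa_const_axis g : gn e s ^ g^-1 = gn e s ^ a^-1 -> kappa b g = kappa b a.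
Proof.
move=> E; have C : commute (gn e s) (a^-1 * g).
  by apply/commgP/conjg_fixP; rewrite conjgM -E conjgKV.
have [w mw wg] := minimal_exists (a^-1 * g).
have st : all (in_star e s) (map fst w).
  apply: (@centralizer_letters s (gen s)) mw; rewrite ?wg //=.
  - by rewrite /in_star eqxx.
  - by rewrite -/(gn e s) (expo_gn symE) eqxx.
rewrite -[g](mulVKg a) kappaM // -wg.
suff -> : kappa (b ^ a) (cl e w) = 0%R by rewrite GRing.addr0.
apply/eqP; apply: contraT => /(kappa_neq0 symE) /mapP [c cw bc]; case: nC.
have [w1 [w2 [Ew ac]]] := crossingP cw.
move: st; rewrite Ew map_cat all_cat /= => /andP [/star_letters_commute C1 /andP [C2 _]].
have C3 : commute (gn e s) (b ^ a).
  rewrite bc ac; apply: commuteM; first exact: commuteV (commuteV C1).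
  apply: commuteM; last exact: commuteV C1.
  by case/orP: C2 => [/eqP -> //|/gn_commute].
by rewrite -(conjgK a b) /commute -!conjMg C3.
Qed.
End TwoAxes.

(** The ping-pong dichotomy, proved by walking from [a] to [g]. The first count changes only on
    steps along the first axis, where [kappa_const_axis] gives the second count its value at [a];
    the roles are symmetric, and other steps change neither count. *)
Lemma kappa_two_axes s t (a b : G) : ~ commute (gn e s ^ a^-1) (gn e t ^ b^-1) ->
  forall g, kappa (gn e s ^ a^-1) g = kappa (gn e s ^ a^-1) b \/
            kappa (gn e t ^ b^-1) g = kappa (gn e t ^ b^-1) a.
Proof.
move=> nC g; rewrite -[g](mulVKg a); elim/clW: (a^-1 * g).
have nC' : ~ commute (gn e t ^ b^-1) (gn e s ^ a^-1) by move/commute_sym.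
apply: last_ind => [|w [u c] IH]; first by right; rewrite cl_nil mulg1.
rewrite -cats1 cl_cat cl_cons cl_nil mulg1 mulgA.
move: (a * cl e w) IH => g0 IH; rewrite !(kappaM symE) !(kappa_letter symE).
have uu : gn e u ^ (letter e (u, c))^-1 = gn e u.
  apply/conjg_fixP/commgP/commuteV; case: c => //; exact: commuteV.
case: eqP => [E|_]; last case: eqP => [E|_].
- right; have us : u = s by apply: (@gnJ_inj _ _ symE _ _ 1 (a^-1 * g0)); rewrite conjg1 conjgM.
  rewrite -(kappa_letter symE) -(kappaM symE). apply: (kappa_const_axis nC).
  by rewrite -{1}us invgM conjgM uu E conjgK.
- left; have us : u = t by apply: (@gnJ_inj _ _ symE _ _ 1 (b^-1 * g0)); rewrite conjg1 conjgM.
  rewrite GRing.addr0; apply: (kappa_const_axis nC').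
  by rewrite -{1}us E conjgK.
- by rewrite !GRing.addr0.
Qed.
End Centralizers.

(** * Conjugating automorphisms without shortenings *)

Section Conjugating.
Variables (V : finType) (e : rel V).
Hypothesis symE : symmetric e.
Local Notation G := (raag e).
Variables (f : G -> G) (k : V -> G).
Hypotheses (fM : {morph f : x y / x * y}) (fI : injective f).
Hypothesis fk : forall v, f (gn e v) = gn e v ^ (k v)^-1.

Lemma conj_letter s b : f (letter e (s, b)) = letter e (s, b) ^ (k s)^-1.
Proof. by case: b; rewrite /letter /= ?(morphV fM) ?fk // conjVg. Qed.

Lemma gn_conj_letter v s b : in_star e s v -> gn e v ^ letter e (s, b) = gn e v.
Proof.
move=> sv; apply/conjg_fixP/commgP.
have C : commute (gn e v) (gn e s).
  by case/orP: sv => [/eqP -> //|/gn_commute].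
by case: b => //; apply: commuteV.
Qed.

(** The image of the letter is the letter conjugated by [k s], and it commutes with [f (gn e v)]; so
    the contributions of [k s] and of its inverse cancel, and only the middle letter counts. *)
Lemma kappa_conj_star v s b x : in_star e s v ->
  kappa (f (gn e v)) (f (letter e (s, b) * x)) =
  ((if s == v then sgn b else 0) + kappa (f (gn e v)) (f x))%R.
Proof.
move=> sv; rewrite fM (kappaM symE) -(morphJ fM) gn_conj_letter //; congr (_ + _)%R.
set a := f (gn e v).
have aE : a ^ f (letter e (s, b)) = a by rewrite -(morphJ fM) gn_conj_letter.
have E2 : ((a ^ k s) ^ letter e (s, b)) ^ (k s)^-1 = a.
  by rewrite -!conjgM -{1}[k s]invgK -conjgE -conj_letter aE.
rewrite conj_letter conjgE invgK !(kappaM symE) (kappaV symE) E2.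
rewrite (kappa_letter symE) GRing.addrC -GRing.addrA GRing.addNr GRing.addr0.
rewrite /a fk; case: (s =P v) => [->|ne]; first by rewrite conjgKV eqxx.
case: eqP => // E; case: ne.
by apply: (@gnJ_inj _ _ symE s v 1 ((k v)^-1 * k s)); rewrite conjg1 conjgM.
Qed.

Hypothesis short : forall v w, ~~ in_star e v w -> kappa (f (gn e v)) (k w) = 0%R.

(** The dichotomy [kappa_two_axes] for the images of [v] and [w]: [short] makes both reference
    values 0. *)
Lemma kappa_conj_dichotomy v w x : ~~ in_star e v w ->
  kappa (f (gn e v)) x = 0%R \/ kappa (f (gn e w)) x = 0%R.
Proof.
move=> nvw; have nC : ~ commute (gn e v ^ (k v)^-1) (gn e w ^ (k w)^-1).
  rewrite -!fk /commute -!fM => /fI /(gn_commute_star symE) vw.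
  by rewrite vw in nvw.
have := kappa_two_axes symE nC x; rewrite -!fk !short //.
by rewrite in_star_sym.
Qed.
End Conjugating.

Section ShortConjugating.
Variables (V : finType) (e : rel V).
Hypothesis symE : symmetric e.
Local Notation G := (raag e).
Variables (f : G -> G) (k : V -> G).
Hypotheses (fM : {morph f : x y / x * y}) (fI : injective f).
Hypothesis fS : forall y, exists x, f x = y.
Hypothesis fk : forall v, f (gn e v) = gn e v ^ (k v)^-1.
Hypothesis short : forall v w, ~~ in_star e v w -> kappa (f (gn e v)) (k w) = 0%R.

(** By induction on [w], the first letter [s] settles every [v] in its star. For other [v] both
    sides vanish, by the dichotomy for [f] and for the identity, since the count along [s] is not
    zero. *)
Lemma short_kappa_gn w v : minimal e w ->
  kappa (f (gn e v)) (f (cl e w)) = kappa (gn e v) (cl e w).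
Proof.
have idM : {morph (@id G) : x y / x * y} by [].
have idk v0 : id (gn e v0) = gn e v0 ^ ((fun=> 1) v0 : G)^-1 by rewrite invg1 conjg1.
elim: w v => [|[s b] w IH] v m; first by rewrite cl_nil (morph1 fM) !kappa1.
have {}IH := IH _ (minimal_behead m).
have star u : in_star e s u ->
    kappa (f (gn e u)) (f (cl e ((s, b) :: w))) = kappa (gn e u) (cl e ((s, b) :: w)).
  move=> su; rewrite cl_cons (kappa_conj_star symE fM fk) // IH.
  by rewrite (kappa_conj_star symE idM idk).
have [/star //|nsv] := boolP (in_star e s v).
have nz : kappa (gn e s) (cl e ((s, b) :: w)) != 0%R.
  have -> : gn e s = axis (s, if b then (gn e s)^-1 else 1, b).
    rewrite /axis /=; case: b {star m} => /=; rewrite ?invgK ?invg1 ?conjg1 //.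
    by apply/esym/conjg_fixP/commgP.
  by apply: (minimal_kappa_neq0 symE m); rewrite inE eqxx.
have sE := star s; rewrite /in_star eqxx in sE.
have [h|->] := kappa_conj_dichotomy symE fM fI fk short (f (cl e ((s, b) :: w))) nsv.
  by move: nz; rewrite -sE // h eqxx.
have idshort v0 w0 : ~~ in_star e v0 w0 -> kappa (id (gn e v0)) (1 : G) = 0%R.
  by rewrite kappa1.
have [h|//] := kappa_conj_dichotomy symE idM (@inj_id _) idk idshort (cl e ((s, b) :: w)) nsv.
by move: nz; rewrite h eqxx.
Qed.

Lemma short_kappa v h x : kappa (f (gn e v ^ h)) (f x) = kappa (gn e v ^ h) x.
Proof.
have gnE y : kappa (f (gn e v)) (f y) = kappa (gn e v) y.
  by have [w mw <-] := minimal_exists y; apply: short_kappa_gn.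
have := gnE (h * x); rewrite fM !(kappaM symE) gnE (morphJ fM).
exact: GRing.addrI.
Qed.

(** Let [x] be the preimage of [gn e s]. Every axis crossed by a minimal word for [x] is sent to an
    axis crossed by the single letter [s], hence is [x] itself. As [kappa x x] is 1, the word is one
    positive letter, and its generator is [s] because [f] is conjugating. *)
Lemma short_conjugating_id s : f (gn e s) = gn e s.
Proof.
have [x fx] := fS (gn e s); have [w mw wx] := minimal_exists x.
have axE c : c \in crossings e w -> axis c = x.
  move=> cw; have := minimal_kappa_neq0 symE mw cw.
  rewrite /axis -short_kappa wx fx (kappa_gn symE).
  by case: (gn e s =P _) => // E _; apply: fI; rewrite fx.
have [c cw] : exists c, c \in crossings e w.
  case: (crossings e w) (size_crossings e w) => [|c r]; last first.
    by exists c; rewrite mem_head.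
  move/esym/size0nil => w0; have := expo_gn symE s s.
  by rewrite -fx -wx w0 cl_nil (morph1 fM) (expo1 symE) eqxx.
have cs : c.1.1 = s.
  apply/esym; apply: (@gnJ_inj _ _ symE _ _ 1 ((k c.1.1)^-1 * f c.1.2^-1)).
  by rewrite conjg1 conjgM -fk -(morphJ fM) -/(axis c) axE.
have : kappa x x = 1%R.
  by rewrite -{1}(axE c cw) /axis -short_kappa -/(axis c) axE // fx (kappa_gn symE) eqxx.
rewrite -{2}wx /kappa /kap cnt_cl //; last exact: kap_inv.
rewrite (minimal_cntw symE mw cw) /=; first last.
- by move=> d dw _; rewrite !axE.
- by rewrite -/(axis c) axE.
rewrite (eq_in_count (a2 := predT)); last first.
  by move=> d dw /=; rewrite -/(axis d) axE // eqxx.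
rewrite count_predT size_crossings => sz.
case: w mw wx axE cw sz => [|[t b] [|u w]] mw wx axE cw sz; rewrite // ?in_nil // in cw.
  move: cw sz; rewrite /= inE => /eqP cE; rewrite cE /= in cs *.
  subst t; case: b mw wx axE cE => // mw wx axE cE _.
  by rewrite -[RHS]fx -wx.
by move: sz; rewrite /sgn /=; case: (c.2); lia.
Qed.
End ShortConjugating.

(** * Limits along lifts *)

Section KapFacts.
Variables (V : finType) (e : rel V).
Hypothesis symE : symmetric e.
Local Notation G := (raag e).
Implicit Types (P : pred G) (x y a : G).

Lemma kap_letter P s b :
  kap P (letter e (s, b)) = (if P (gn e s) then sgn b else 0%R).
Proof.
have -> : letter e (s, b) = cl e [:: (s, b)] by rewrite cl_cons cl_nil mulg1.
rewrite /kap cnt_cl //; last exact: kap_inv.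
rewrite cntw1; case: b; rewrite ?invgK ?invg1 ?conjg1 //.
by have -> : gn e s ^ gn e s = gn e s by apply/conjg_fixP/commgP.
Qed.

Lemma kap1 P : kap P (1 : G) = 0%R.
Proof. by rewrite -cl_nil kap_cl // big_nil. Qed.

Lemma kap_sum P w (D : seq G) : uniq D -> {subset axes e w <= D} ->
  kap P (cl e w) = (\sum_(a <- D | P a) kappa a (cl e w))%R.
Proof.
move=> uD; rewrite kap_cl // (eq_bigr (fun a =>
    \sum_(c <- crossings e w | axis c == a) sgn c.2)%R); last first.
  by move=> a _; rewrite /kappa kap_cl.
rewrite /axes; elim: (crossings e w) => [|c r IH] sub.
  by rewrite big_nil big1 // => a _; rewrite big_nil.
rewrite big_cons.
under [RHS]eq_bigr => a _ do rewrite big_cons.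
rewrite IH; last first.
  by move=> a ar; apply: sub; rewrite inE ar orbT.
have cD : axis c \in D by apply: sub; rewrite mem_head.
rewrite [RHS](eq_bigr (fun a => (if axis c == a then sgn c.2 else 0) +
    \sum_(d <- r | axis d == a) sgn d.2)%R); last first.
  by move=> a _; case: eqP; rewrite ?GRing.add0r.
rewrite big_split /=.
have -> : (\sum_(a <- D | P a) (if axis c == a then sgn c.2 else 0) =
           if P (axis c) then sgn c.2 else 0)%R.
  rewrite big_mkcond (bigD1_seq (axis c)) //= eqxx big1 ?GRing.addr0 //.
  by move=> a ne; rewrite eq_sym (negbTE ne); case: (P a).
by case: (P (axis c)); rewrite ?GRing.add0r.
Qed.

Lemma eq_kap P x y : (forall a, P a -> kappa a x = kappa a y) -> kap P x = kap P y.
Proof.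
elim/clW: x; elim/clW: y => y x h.
set D := undup (axes e x ++ axes e y).
rewrite !(@kap_sum P _ D) ?undup_uniq //; first exact: eq_bigr.
- by move=> a ay; rewrite mem_undup mem_cat ay orbT.
- by move=> a ay; rewrite mem_undup mem_cat ay.
Qed.

Lemma kappa_gnX v s h n : v != s -> kappa (gn e v ^ h) (gn e s ^+ n) = 0%R.
Proof.
move=> ne; elim: n h => [|n IH] h; first by rewrite kappa1.
rewrite expgS (kappaM symE) -conjgM IH (kappa_gn symE).
case: (gn e s =P _) => // E; case/eqP: ne.
by apply/esym/(@gnJ_inj _ _ symE s v 1 h); rewrite conjg1.
Qed.
End KapFacts.

Section Lift.
Variables (W V : finType) (eL : rel W) (eG : rel V) (phi : W -> V).
Hypotheses (symL : symmetric eL) (irrL : irreflexive eL).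
Hypothesis symG : symmetric eG.
Hypothesis phiE : forall u u', eL u u' -> eG (phi u) (phi u').
Local Notation L := (raag eL).
Local Notation G := (raag eG).

Definition raag_map : L -> G := @ev W eL G (fun u => gn eG (phi u)).
Local Notation Phi := raag_map.

Let phiC u u' (h : eL u u') : commute (gn eG (phi u)) (gn eG (phi u')) :=
  gn_commute (phiE h).

Lemma raag_mapM : {morph Phi : x y / x * y}.
Proof. exact: evM phiC. Qed.

Lemma raag_map_gn u : Phi (gn eL u) = gn eG (phi u).
Proof. exact: ev_gn phiC u. Qed.

Lemma raag_map_letter u b : Phi (letter eL (u, b)) = letter eG (phi u, b).
Proof. by case: b; rewrite /letter /= ?(morphV raag_mapM) raag_map_gn. Qed.

Lemma raag_map_cl w : Phi (cl eL w) = cl eG (map_word phi w).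
Proof.
elim: w => [|[u b] w IH]; first by rewrite !cl_nil (morph1 raag_mapM).
by rewrite /= !cl_cons raag_mapM IH raag_map_letter.
Qed.

(** Mapping letters carries crossings to crossings and axes to their images, so a count downstairs
    splits over the axes above. *)
Lemma kap_raag_map (P : pred G) y : kap P (Phi y) = kap (fun a => P (Phi a)) y.
Proof.
elim/clW: y => w; elim: w P => [|[u b] w IH] P.
  by rewrite cl_nil (morph1 raag_mapM) !kap1.
rewrite cl_cons raag_mapM !kapM // raag_map_letter !kap_letter // raag_map_gn IH.
congr (_ + _)%R; apply: kap_ext => a.
by rewrite (morphJ raag_mapM) (morphV raag_mapM) raag_map_letter.
Qed.

(** A minimal word for [b] has a letter [vt] above [v], since the exponent of [v] in its image is 1;
    a generator commuting with [b] has all letters of that word in its star. *)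
Lemma lift_of_gn_star b v : Phi b = gn eG v ->
  exists2 vt, phi vt = v & forall z, commute (gn eL z) b -> in_star eL vt z.
Proof.
have [w mw <-] := minimal_exists b; rewrite raag_map_cl => E.
have : expo v (cl eG (map_word phi w)) != 0%R by rewrite E (expo_gn symG) eqxx.
move/(expo_cl_neq0 symG); rewrite /map_word -map_comp => /mapP [[vt c] vtw /= vE].
exists vt => // z C; rewrite in_star_sym //.
have /allP-> // : all (in_star eL z) (map fst w); last by apply/mapP; exists (vt, c).
apply: (@centralizer_letters _ _ symL z (gen z)) mw => //=.
- by rewrite /in_star eqxx.
- by rewrite -/(gn eL z) (expo_gn symL) eqxx.
Qed.

Variables (F Fi : L -> L) (f : G -> G) (k : V -> G).
Hypotheses (FM : {morph F : x y / x * y}) (FK : cancel F Fi) (FiK : cancel Fi F).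
Hypotheses (fM : {morph f : x y / x * y}) (fI : injective f).
Hypothesis fk : forall v, f (gn eG v) = gn eG v ^ (k v)^-1.
Hypothesis PhiF : forall y, Phi (F y) = f (Phi y).

Lemma kappa_conj_power v w : ~~ in_star eG w v ->
  exists N, forall n, N <= n ->
    kappa (f (gn eG v)) (f (gn eG w ^+ n)) = kappa (f (gn eG v)) (k w).
Proof.
move=> nwv; set a := f (gn eG v).
have aE n : (a ^ k w) ^ (gn eG w ^+ n) = f (gn eG v ^ (gn eG w ^+ n)) ^ k w.
  rewrite (morphJ fM) (morphX fM) (fk w) -conjXg -/a -!conjgM; congr (_ ^ _).
  by rewrite conjgE invgK -!mulgA mulVg mulg1.
have [|N HN] := @eventually_not _ (axes eG (repr (k w)^-1))
    (fun n b => b = (a ^ k w) ^ (gn eG w ^+ n)).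
  move=> b n m -> E; apply: (conj_gn_powers_inj symG nwv).
  by apply/fI/(@conjg_inj _ (k w)); rewrite -!aE.
exists N => n le; rewrite (morphX fM) (fk w) -conjXg conjgE invgK !(kappaM symG).
have ne : v != w by apply: contraNneq nwv => ->; rewrite /in_star eqxx.
rewrite {2}/a fk -conjgM kappa_gnX // GRing.add0r.
suff -> : kappa ((a ^ k w) ^ (gn eG w ^+ n)) (k w)^-1 = 0%R by rewrite GRing.addr0.
apply/eqP; apply: contraT; rewrite -{1}(cl_repr (k w)^-1) => /(kappa_neq0 symG).
by move/(HN n le).
Qed.

(** The bound [N] is chosen through images under [raag_map], so one bound serves all [a] above
    [f (gn eG v)]. *)
Lemma kappa_lift_stable v u : ~~ in_star eG (phi u) v ->
  exists N, forall n, N <= n -> forall a, Phi a = f (gn eG v) ->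
    kappa a (F (gn eL u ^+ n)) = kappa a (F (gn eL u ^+ N)).
Proof.
move=> nuv.
have [|N HN] := @eventually_not _ (axes eL (repr (F (gn eL u))))
    (fun n b => Phi b = f (gn eG v ^ (gn eG (phi u) ^+ n))).
  by move=> b n m -> /fI; apply: (conj_gn_powers_inj symG nuv).
exists N => n /subnK <-; elim: (n - N) => [//|d IH] a Pa.
rewrite addSn expgSr FM (kappaM symL) IH //.
set x := F (_ ^+ (d + N)); suff -> : kappa (a ^ x) (F (gn eL u)) = 0%R by rewrite GRing.addr0.
apply/eqP; apply: contraT; rewrite -{1}(cl_repr (F (gn eL u))) => /(kappa_neq0 symL).
move/(HN _ (leq_addl d N)); case.
by rewrite (morphJ raag_mapM) Pa PhiF (morphX raag_mapM) raag_map_gn (morphJ fM).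
Qed.

Section Chain.
Variable a : L.
Local Notation b := (Fi a).

(** By [conj_powers_inj], each of the finitely many axes of [F (gn eL z')] can matter for one [n]
    only, whatever the exponent of [z']; hence a bound uniform in [m]. *)
Lemma kappa_half z z' : eL z z' -> ~ commute (gn eL z) b ->
  exists N, forall n m, N <= n ->
    kappa a (F (gn eL z ^+ n * gn eL z' ^+ m)) = kappa a (F (gn eL z ^+ n)).
Proof.
move=> zz' nC.
have [|N HN] := @eventually_not _ (axes eL (repr (F (gn eL z'))))
    (fun n c => exists j, c = F (b ^ (gn eL z ^+ n * gn eL z' ^+ j))).
  move=> c n m [j ->] [i /(can_inj FK)].
  exact: (conj_powers_inj symL irrL zz' nC).
exists N => n m le; elim: m => [|m IH]; first by rewrite mulg1.
rewrite expgSr mulgA FM (kappaM symL) IH.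
set x := F (_ * _); suff -> : kappa (a ^ x) (F (gn eL z')) = 0%R by rewrite GRing.addr0.
apply/eqP; apply: contraT; rewrite -{1}(cl_repr (F (gn eL z'))) => /(kappa_neq0 symL).
move/(HN _ le); case; exists m.
by rewrite (morphJ FM) FiK.
Qed.

(** Equality of two limits, including their existence. *)
Definition same_end z z' := exists N, forall n m, N <= n -> N <= m ->
  kappa a (F (gn eL z ^+ n)) = kappa a (F (gn eL z' ^+ m)).

Lemma same_end_adj z z' : eL z z' ->
  ~ commute (gn eL z) b -> ~ commute (gn eL z') b -> same_end z z'.
Proof.
move=> zz' nz nz'; have [N1 H1] := kappa_half zz' nz.
have [N2 H2] : exists N, forall n m, N <= n ->
    kappa a (F (gn eL z' ^+ n * gn eL z ^+ m)) = kappa a (F (gn eL z' ^+ n)).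
  by apply: kappa_half nz'; rewrite symL.
exists (maxn N1 N2) => n m; rewrite !geq_max => /andP [n1 _] /andP [_ m2].
rewrite -(H1 n m n1) -(H2 m n m2); congr (kappa a (F _)).
exact/commuteX2/gn_commute.
Qed.

Lemma same_end_trans z2 z1 z3 : same_end z1 z2 -> same_end z2 z3 -> same_end z1 z3.
Proof.
move=> [N1 H1] [N2 H2]; exists (maxn N1 N2) => n m; rewrite !geq_max.
move=> /andP [n1 n2] /andP [m1 m2]; rewrite (H1 n (maxn N1 N2)) ?leq_maxl //.
by apply: H2; rewrite ?leq_maxr.
Qed.
End Chain.

Definition away (vt : W) : rel W :=
  [rel x y | [&& eL x y, ~~ in_star eL vt x & ~~ in_star eL vt y]].

(** No vertex off the star of [vt] commutes with [Fi a], so [same_end_adj] applies along the path.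
    The case [u = u'] is separate because an empty path gives no convergence at [u]. *)
Lemma same_end_connect a vt u u' :
  (forall z, commute (gn eL z) (Fi a) -> in_star eL vt z) ->
  connect (away vt) u u' -> u = u' \/ same_end a u u'.
Proof.
move=> st /connectP [p pth ->]; elim: p u pth => [|x p IH] u /=; first by left.
case/andP => /and3P [ux nu nx] /IH h; right.
have E : same_end a u x.
  by apply: same_end_adj => // /st; apply/negP.
by case: h => [<- //|]; apply: same_end_trans.
Qed.

(** Both sides are limits of counts downstairs, which split into counts over all [a] above
    [f (gn eG v)]. For each [a], the letter [vt] of [Fi a] above [v] gives a star to avoid, and the
    path off this star identifies the limits. *)
Lemma kappa_conj_connect v u u' :
  ~~ in_star eG v (phi u) -> ~~ in_star eG v (phi u') ->
  (forall vt, phi vt = v -> connect (away vt) u u') ->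
  kappa (f (gn eG v)) (k (phi u)) = kappa (f (gn eG v)) (k (phi u')).
Proof.
rewrite !(in_star_sym symG v) => nu nu' con.
have [N1 H1] := kappa_conj_power nu; have [N2 H2] := kappa_conj_power nu'.
have [M1 S1] := kappa_lift_stable nu; have [M2 S2] := kappa_lift_stable nu'.
pose n := maxn (maxn N1 N2) (maxn M1 M2).
rewrite -(H1 n) ?/n; last by lia.
rewrite -(H2 n) ?/n; last by lia.
rewrite -!raag_map_gn -!(morphX raag_mapM) -!PhiF /kappa !kap_raag_map.
apply: eq_kap => // a /eqP Pa.
have Pb : Phi (Fi a) = gn eG v by apply: fI; rewrite -PhiF FiK.
have [vt vtE st] := lift_of_gn_star Pb.
have [-> //|[N HN]] := same_end_connect st (con vt vtE).
(* The bound [N] depends on [a], but [n] does not; uniform stability allows passing to exponents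
   beyond [N]. *)
rewrite S1 // ?S2 //; try lia.
rewrite -(S1 (maxn N M1)) ?leq_maxr // -(S2 (maxn N M2)) ?leq_maxr //.
by apply: HN; rewrite leq_maxl.
Qed.
End Lift.

Arguments away W eL vt /.
Arguments raag_map {W V} eL eG phi x.

(** * Regular coverings *)

Section Connect.
Variables (T T' : finType).

Lemma connect_rind (r : rel T) (P : T -> Prop) x : P x ->
  (forall y z, connect r x y -> P y -> r y z -> P z) ->
  forall y, connect r x y -> P y.
Proof.
move=> Px step y /connectP [p pth ->] {y}; elim/last_ind: p pth => [//|p y IH].
rewrite rcons_path last_rcons => /andP [pth ry].
apply: step ry; last exact: IH.
by apply/connectP; exists p.
Qed.

Lemma connect_homo (r : rel T) (r' : rel T') (h : T -> T') x y :
  (forall a b, r a b -> r' (h a) (h b)) -> connect r x y -> connect r' (h x) (h y).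
Proof.
move=> hr; elim/connect_rind: y / => [|y z _ IH /hr yz]; first exact: connect0.
exact: connect_trans IH (connect1 yz).
Qed.
End Connect.

Section Cover.
Variables (W V : finType) (eL : rel W) (eG : rel V) (phi : W -> V).
Hypothesis symL : symmetric eL.
Hypotheses (symG : symmetric eG) (irrG : irreflexive eG).
Hypothesis reg : regular_covering eL eG phi.
Local Notation away := (away eL).

Lemma cover_edge u u' : eL u u' -> eG (phi u) (phi u').
Proof. by case: reg => [[_ [h _]] _]; apply: h. Qed.

Lemma cover_lift u v : eG (phi u) v -> exists2 u', eL u u' & phi u' = v.
Proof. by case: reg => [[_ [_ [_ h]]] _]; apply: h. Qed.

Lemma fiber_nonadj x y : phi x = phi y -> eL x y = false.
Proof. by move=> E; apply/negP => /cover_edge; rewrite E irrG. Qed.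

Lemma fiber_star_disjoint x y t :
  phi x = phi y -> x != y -> in_star eL x t -> ~~ in_star eL y t.
Proof.
move=> E ne; rewrite /in_star negb_or => /orP [/eqP ->|xt].
  by rewrite ne fiber_nonadj.
apply/andP; split.
  by apply/eqP => tE; rewrite tE fiber_nonadj in xt.
apply/negP => yt; case/eqP: ne; case: reg => [[_ [_ [inj _]]] _].
by apply: (inj t _ _ _ _ E); rewrite unfold_in /= symL.
Qed.

Lemma fiber_notin_star x y : phi x = phi y -> x != y -> ~~ in_star eL y x.
Proof.
by move=> E ne; apply: (fiber_star_disjoint E ne); rewrite /in_star eqxx.
Qed.

Lemma away_sym x : symmetric (away x).
Proof. by move=> a b; rewrite /= symL; case: (eL b a) => //=; rewrite andbC. Qed.

Lemma connect_awayC x : connect_sym (away x).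
Proof. exact/sym_connect_sym/away_sym. Qed.

Lemma connect_away_eL x a b : connect (away x) a b -> connect eL a b.
Proof. by apply: connect_sub => y z /and3P [yz _ _]; apply: connect1. Qed.

Lemma connect_away_notin x a b :
  ~~ in_star eL x a -> connect (away x) a b -> ~~ in_star eL x b.
Proof. by move=> na; elim/connect_rind: b / => // y z _ _ /and3P []. Qed.

(* A fibre element whose complementary component around [b] is largest cannot
   separate [b] from another element of the fibre. *)
Lemma noncut_exists b c : phi c = phi b -> c != b -> connect eL b c ->
  exists vs, [/\ phi vs = phi b, vs != b, connect eL b vs &
    forall y, phi y = phi b -> connect eL b y -> y != vs -> connect (away vs) b y].
Proof.
move=> cb ncb con.
pose P x := [&& phi x == phi b, x != b & connect eL b x].
have Pc : P c by rewrite /P cb eqxx ncb.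
case: (@arg_maxnP _ c P (fun x => #|[pred t | connect (away x) b t]|) Pc).
move=> vs /and3P [/eqP vsb nvsb cvs] mx; exists vs; split=> // y yb cy nyvs.
apply: contraT => ny.
have nyb : y != b by apply: contraNneq ny => ->; apply: connect0.
have /mx /= : P y by rewrite /P yb eqxx nyb.
have yvs : phi y = phi vs by rewrite yb.
have nb_vs : ~~ in_star eL vs b by apply: fiber_notin_star; rewrite // eq_sym.
have nb_y : ~~ in_star eL y b by apply: fiber_notin_star; rewrite // eq_sym.
have ny_vs : ~~ in_star eL vs y by apply: fiber_notin_star.
have nvs_y : ~~ in_star eL y vs by apply: fiber_notin_star; rewrite // eq_sym.
have off t : connect (away vs) b t -> ~~ in_star eL y t.
  move=> ct; apply: contra ny; case/orP => [/eqP <- //|yt].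
  apply: connect_trans ct (connect1 _); rewrite /= symL yt ny_vs andbT.
  by apply: fiber_star_disjoint yvs nyvs _; rewrite /in_star yt orbT.
have sub t : connect (away vs) b t -> connect (away y) b t.
  move=> ct; move: (ct); elim/connect_rind: t / ct => [//|t z ct IH tz cz].
  apply: connect_trans (IH ct) (connect1 _); rewrite /= !off //.
  by case/and3P: tz => ->.
(* A walk from [b] to [vs] stays in the component of [b] until it enters the star of [vs], which is
   disjoint from the star of [y]. So [y] would have a strictly larger component than [vs]. *)
have cyvs : connect (away y) b vs.
  have reach t : connect eL b t -> connect (away vs) b t \/ connect (away y) b vs.
    elim/connect_rind: t / => [|t z _ [ct|] tz]; [by left| |by right].
    have nt := connect_away_notin nb_vs ct.
    have [zs|nz] := boolP (in_star eL vs z); last first.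
      by left; apply: connect_trans ct (connect1 _); rewrite /= tz nt.
    right; have nzy : ~~ in_star eL y z.
      by apply: fiber_star_disjoint zs; rewrite // eq_sym.
    have cz : connect (away y) b z.
      by apply: connect_trans (sub t ct) (connect1 _); rewrite /= tz off.
    case/orP: zs => [/eqP <- //|vz].
    by apply: connect_trans cz (connect1 _); rewrite /= symL vz nzy.
  case: (reach vs cvs) => // /(connect_away_notin nb_vs).
  by rewrite /in_star eqxx.
rewrite leqNgt => /negP []; apply: proper_card; apply/properP; split.
  by apply/subsetP => t; rewrite !inE; apply: sub.
exists vs; rewrite !inE //; apply/negP => /(connect_away_notin nb_vs).
by rewrite /in_star eqxx.
Qed.

(** By regularity, a deck transformation carries the non-separating vertex [vs] found from [v1] to
    [v0]. *)
Lemma noncut v0 v1 v2 : phi v1 = phi v0 -> phi v2 = phi v0 -> v1 != v0 -> v2 != v0 ->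
  connect eL v0 v1 -> connect eL v0 v2 -> connect (away v0) v1 v2.
Proof.
have symcL := sym_connect_sym symL.
move=> p1 p2 n1 n2 c1 c2.
have [||| vs [pvs nvs cvs far]] := @noncut_exists v1 v0; rewrite ?p1 1?eq_sym // 1?symcL //.
have [mu [[[nu muK nuK] muE] muP] muvs] : exists2 mu, deck eL phi mu & mu vs = v0.
  by case: reg => _; apply; rewrite pvs p1.
have nuE a b : eL (nu a) (nu b) = eL a b by rewrite -muE !nuK.
have nuP a : phi (nu a) = phi a by rewrite -[in RHS](nuK a) muP.
have nu0 : nu v0 = vs by rewrite -muvs muK.
have conv x : phi x = phi v0 -> x != v0 -> connect eL v0 x ->
    connect (away vs) v1 (nu x).
  move=> px nx cx; apply: far.
  - by rewrite nuP px.
  - apply: connect_trans cvs _; rewrite -nu0.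
    by apply: connect_homo cx => a b; rewrite nuE.
  - by apply: contraNneq nx => E; rewrite -(nuK x) E muvs.
have : connect (away vs) (nu v1) (nu v2).
  by apply: (connect_trans _ (conv v2 p2 n2 c2)); rewrite connect_awayC conv.
move=> /(@connect_homo _ _ _ (away v0) mu); rewrite !nuK; apply=> a b.
by rewrite /= /in_star -muvs !muE !(inj_eq (can_inj muK)).
Qed.

(** * Components over a part of the complement of a star *)

Variable v : V.

Definition rel_over (C : {set V}) : rel W :=
  [rel x y | [&& eL x y, phi x \in C & phi y \in C]].

Arguments rel_over C /.

(** Here [x] runs through the component of [u] in the preimage of [C], and [t] is a vertex of the
    link of [vt] next to it. *)
Definition touches (C : {set V}) (u vt : W) : bool :=
  (phi vt == v) &&
  [exists x, exists t, [&& connect (rel_over C) u x, eL x t & eL vt t]].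

Definition off_star (C : {set V}) := forall w, w \in C -> ~~ in_star eG v w.

Lemma off_star_lift C vt z : off_star C -> phi vt = v -> phi z \in C ->
  ~~ in_star eL vt z.
Proof.
move=> offC vtE zC; apply: contra (offC _ zC); rewrite /in_star -vtE.
by case/orP => [/eqP ->|/cover_edge ->]; rewrite ?eqxx ?orbT.
Qed.

Lemma touches_connect C u a vt : off_star C -> phi u \in C -> touches C u a ->
  phi vt = v -> vt != a -> connect (away vt) u a.
Proof.
move=> offC uC /andP [/eqP av /existsP [x /existsP [t /and3P [ux xt at_]]]] vtv ne.
have xC : phi x \in C.
  by elim/connect_rind: x / ux {xt} => // y z _ _ /and3P [].
have E : phi a = phi vt by rewrite av.
have nt : ~~ in_star eL vt t.
  by apply: fiber_star_disjoint E _ _; rewrite 1?eq_sym // /in_star at_ orbT.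
apply: (@connect_trans _ _ x).
  apply: connect_sub ux => y z /and3P [yz yC zC]; apply: connect1.
  by rewrite /= yz !(off_star_lift offC vtv).
apply: (@connect_trans _ _ t); apply: connect1; rewrite /= nt.
  by rewrite xt (off_star_lift offC vtv).
by rewrite symL at_ fiber_notin_star // eq_sym.
Qed.

(** Constant on each component over [C] and adjacent to all of its boundary: this makes conjugation
    by [tau u] compatible with the edges. *)
Definition isolating (C : {set V}) (tau : W -> W) := forall u, phi u \in C ->
  phi (tau u) = v /\
  forall u', eL u u' -> if phi u' \in C then tau u' = tau u else eL (tau u) u'.

(** A neighbour outside the preimage of [C] lies over the link of [v]; lifting its edge to [v]
    produces a lift touched by the component, which by uniqueness is the chosen one. *)
Lemma isolating_exists C : union_comp_compl_star eG v C ->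
  (forall u a b, phi u \in C -> touches C u a -> touches C u b -> a = b) ->
  exists tau, isolating C tau.
Proof.
move=> [offC clC] uni; have [v0 v0E] : exists v0, phi v0 = v by case: reg => [[h _] _].
(* The default [v0] serves the components that touch no lift of [v]. *)
pose tau u := odflt v0 [pick a | touches C u a].
exists tau => u uC; split.
  by rewrite /tau; case: pickP => [a /andP [/eqP]|].
move=> u' uu'; case: ifP => [u'C|u'C].
  rewrite /tau; congr odflt; apply: eq_pick => a; rewrite /touches; congr (_ && _).
  apply: eq_existsb => x; apply: eq_existsb => t; congr (_ && _).
  have symr : symmetric (rel_over C).
    by move=> y z; rewrite /= symL; case: (eL z y) => //=; rewrite andbC.
  by apply: (same_connect (sym_connect_sym symr)); apply: connect1; rewrite /= symL uu' uC u'C.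
have st : in_star eG v (phi u').
  apply: contraFT u'C => nst; apply: (clC (phi u)) => //; exact: cover_edge.
have vu' : eG (phi u') v.
  case/orP: st => [/eqP E|]; last by rewrite symG.
  have /negP[] := offC _ uC; rewrite /in_star -E symG.
  by rewrite (cover_edge uu') orbT.
have [a u'a aE] := cover_lift vu'.
have ta : touches C u a.
  rewrite /touches aE eqxx; apply/existsP; exists u; apply/existsP; exists u'.
  by rewrite connect0 uu' symL.
rewrite /tau; case: pickP => [a' /(uni _ _ _ uC ta) <- /=|]; first by rewrite symL.
by move/(_ a); rewrite ta.
Qed.

(** A deck transformation moves [a'] to [a], so that both components touch [a]. Off the star of any
    other lift they are joined through [a]; off the star of [a] they are joined through their second
    lifts, by [noncut]. *)
Lemma touches_twice C C' u u' a b a' b' : off_star C -> off_star C' ->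
  phi u \in C -> phi u' \in C' ->
  touches C u a -> touches C u b -> a != b ->
  touches C' u' a' -> touches C' u' b' -> a' != b' ->
  exists2 u1, phi u1 = phi u' & forall vt, phi vt = v -> connect (away vt) u u1.
Proof.
move=> offC offC' uC u'C' ta tb nab ta' tb' nab'.
have symcL := sym_connect_sym symL.
have pE x c D : touches D x c -> phi c = v by case/andP => /eqP.
have [mu [[[nu muK nuK] muE] muP] mua] : exists2 mu, deck eL phi mu & mu a' = a.
  by case: reg => _; apply; rewrite (pE _ _ _ ta) (pE _ _ _ ta').
have tmu x : touches C' u' x -> touches C' (mu u') (mu x).
  case/andP => xE /existsP [y /existsP [t /and3P [uy yt xt]]].
  rewrite /touches muP xE; apply/existsP; exists (mu y); apply/existsP; exists (mu t).
  rewrite !muE yt xt !andbT; apply: connect_homo uy => p q /=.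
  by rewrite muE !muP.
exists (mu u') => [|vt vtv]; first by rewrite muP.
have u1C : phi (mu u') \in C' by rewrite muP.
have t1a : touches C' (mu u') a by rewrite -mua; apply: tmu.
have t1b := tmu _ tb'; set b1 := mu b' in t1b.
have nab1 : a != b1 by rewrite -mua (inj_eq (can_inj muK)).
have [->|ne] := eqVneq vt a; last first.
  apply: (connect_trans (touches_connect offC uC ta vtv ne)).
  by rewrite connect_awayC; apply: (touches_connect offC').
have aE := pE _ _ _ ta.
have ub := touches_connect offC uC tb aE nab.
have u1b := touches_connect offC' u1C t1b aE nab1.
apply: (connect_trans ub); rewrite connect_awayC; apply: (connect_trans u1b).
apply: noncut; rewrite ?(pE _ _ _ t1b) ?(pE _ _ _ tb) ?aE // 1?eq_sym //.
  apply: connect_trans (connect_away_eL u1b); rewrite symcL.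
  apply: connect_away_eL (touches_connect offC' u1C t1a (pE _ _ _ t1b) _).
  by rewrite eq_sym.
apply: connect_trans (connect_away_eL ub); rewrite symcL.
apply: connect_away_eL (touches_connect offC uC ta (pE _ _ _ tb) _).
by rewrite eq_sym.
Qed.

Lemma isolating_dichotomy C C' :
  union_comp_compl_star eG v C -> union_comp_compl_star eG v C' ->
  (forall u u', phi u \in C -> phi u' \in C' ->
     ~ (forall vt, phi vt = v -> connect (away vt) u u')) ->
  (exists tau, isolating C tau) \/ (exists tau, isolating C' tau).
Proof.
move=> uC uC' sep.
have bad D : union_comp_compl_star eG v D -> ~ (exists tau, isolating D tau) ->
    exists u a b, [/\ phi u \in D, touches D u a, touches D u b & a != b].
  move=> uD /(contra_not (isolating_exists uD)) /existsNP [u] /existsNP [a].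
  move=> /existsNP [b] /not_implyP [uDu] /not_implyP [ta] /not_implyP [tb] /eqP ab.
  by exists u, a, b.
have [?|/(bad _ uC) [u [a [b [uCu ta tb ab]]]]] := pselect (exists tau, isolating C tau).
  by left.
have [?|/(bad _ uC') [u' [a' [b' [uCu' ta' tb' ab']]]]] :=
    pselect (exists tau, isolating C' tau).
  by right.
have [u1 u1E con] := touches_twice uC.1 uC'.1 uCu uCu' ta tb ab ta' tb' ab'.
by case: (sep u u1) => //; rewrite u1E.
Qed.
End Cover.

(** * Endomorphisms given on generators *)

Section Endomorphisms.
Variables (V : finType) (e : rel V).
Implicit Types f g : V -> word V.
Local Notation G := (raag e).

Definition hom f : G -> G := @ev V e G (fun v => cl e (f v)).

Lemma is_endoP f :
  is_endo e f <-> forall u v, e u v -> commute (cl e (f u)) (cl e (f v)).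
Proof.
split=> h u v /h; first by move/clP; rewrite !cl_cat.
by move=> C; apply/clP; rewrite !cl_cat.
Qed.

Lemma homM f : is_endo e f -> {morph hom f : x y / x * y}.
Proof. by move/is_endoP=> h; apply: evM. Qed.

Lemma hom_gn f v : is_endo e f -> hom f (gn e v) = cl e (f v).
Proof. by move/is_endoP=> h; apply: ev_gn. Qed.

Lemma cl_subst f w : cl e (subst f w) = evw (fun v => cl e (f v)) w.
Proof.
elim: w => [|[v b] w IH] //=; rewrite [subst _ _]/= cl_cat -/(subst f w) IH.
by case: b; rewrite ?cl_inv.
Qed.

Lemma hom_cl f w : is_endo e f -> hom f (cl e w) = cl e (subst f w).
Proof. by move/is_endoP=> h; rewrite cl_subst /hom ev_cl. Qed.

Lemma cl_comp f g v : is_endo e f -> cl e (comp f g v) = hom f (cl e (g v)).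
Proof. by move=> h; rewrite hom_cl. Qed.

Lemma is_endo_comp f g : is_endo e f -> is_endo e g -> is_endo e (comp f g).
Proof.
move=> hf /is_endoP hg; apply/is_endoP => u v uv.
by rewrite !cl_comp // /commute -!homM // hg.
Qed.

Lemma hom_comp f g : is_endo e f -> is_endo e g -> hom (comp f g) =1 hom f \o hom g.
Proof.
move=> hf hg; have hfg := is_endo_comp hf hg; apply: morph_ext.
- exact: homM.
- by move=> x y /=; rewrite !homM.
- by move=> v /=; rewrite !hom_gn // cl_comp.
Qed.

Lemma inverse_endoP f g : is_endo e f ->
  inverse_endo e f g <-> [/\ is_endo e g, cancel (hom f) (hom g) & cancel (hom g) (hom f)].
Proof.
have canP f1 f2 : is_endo e f1 -> is_endo e f2 ->
    endo_eq e (comp f1 f2) (@idmap V) <-> cancel (hom f2) (hom f1).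
  move=> h1 h2; split=> [E x|K v].
    rewrite -[LHS]/((hom f1 \o hom f2) x) -hom_comp //; move: x.
    apply: (@morph_ext _ _ _ _ id) => //; first exact/homM/is_endo_comp.
    by move=> v; rewrite hom_gn; [apply/clP/E | apply: is_endo_comp].
  by apply/clP; rewrite cl_comp // -hom_gn // K.
move=> hf; split=> [[hg [E1 E2]]|[hg K1 K2]].
  by split=> //; apply/canP.
by split=> //; split; apply/canP.
Qed.

Lemma is_aut_comp f g : is_aut e f -> is_aut e g -> is_aut e (comp f g).
Proof.
move=> [hf [f' /(inverse_endoP _ hf) [hf' K1 K2]]] [hg [g' /(inverse_endoP _ hg) [hg' K3 K4]]].
have hfg := is_endo_comp hf hg; split=> //; exists (comp g' f').
apply/inverse_endoP => //; split; first exact: is_endo_comp.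
- by move=> x; rewrite !hom_comp //= K1 K3.
- by move=> x; rewrite !hom_comp //= K4 K2.
Qed.

Lemma inverse_endo_sym f g : is_endo e f -> inverse_endo e f g -> inverse_endo e g f.
Proof.
by move=> hf /(inverse_endoP _ hf) [hg K1 K2]; apply/inverse_endoP.
Qed.
End Endomorphisms.

Arguments hom {V} e f x.

(** * Conjugations by a generator that varies with the component *)

Section Twist.
Variables (V : finType) (e : rel V).
Hypothesis symE : symmetric e.

(** Common form of a partial conjugation, where [tau] is constant, and of its lift, where each
    component has its own conjugating vertex. *)
Definition twist (D : pred V) (tau : V -> V) (b : bool) : V -> word V :=
  fun u => if D u then [:: (tau u, b); (u, false); (tau u, ~~ b)] else gen u.

Lemma cl_twist D tau b u : cl e (twist D tau b u) =
  if D u then gn e u ^ letter e (tau u, ~~ b) else gn e u.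
Proof.
rewrite /twist; case: (D u) => //.
by rewrite !cl_cons cl_nil mulg1 conjgE letterN invgK.
Qed.

Variables (D : pred V) (tau : V -> V).
Hypothesis tauD : forall u, D u -> ~~ D (tau u).
Hypothesis tauE : forall u u', D u -> e u u' ->
  if D u' then tau u' = tau u else in_star e (tau u) u'.

(** The ends of an edge inside [D] are conjugated by the same letter; an edge leaving [D] ends in
    the star of [tau u], where this conjugation changes nothing. *)
Lemma twist_endo b : is_endo e (twist D tau b).
Proof.
suff half u v : D u -> e u v ->
    commute (cl e (twist D tau b u)) (cl e (twist D tau b v)).
  apply/is_endoP => u v uv; have [Du|nDu] := boolP (D u); first exact: half.
  have [Dv|nDv] := boolP (D v); first by apply/commute_sym/half; rewrite // symE.
  by rewrite !cl_twist (negbTE nDu) (negbTE nDv); apply: gn_commute.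
move=> Du uv; rewrite !cl_twist Du; have := tauE Du uv.
case: ifP => [Dv ->|Dv st]; first by rewrite /commute -!conjMg (gn_commute uv).
have -> : gn e v = gn e v ^ letter e (tau u, ~~ b) by rewrite gn_conj_letter.
by rewrite /commute -!conjMg (gn_commute uv).
Qed.

Lemma twist_inverse b : inverse_endo e (twist D tau b) (twist D tau (~~ b)).
Proof.
have canc c : cancel (hom e (twist D tau c)) (hom e (twist D tau (~~ c))).
  have h1 := twist_endo c; have h2 := twist_endo (~~ c).
  have cM : {morph hom e (twist D tau (~~ c)) \o hom e (twist D tau c) : x y / x * y}.
    by move=> x y /=; rewrite !homM.
  apply: (morph_ext cM) => // u /=; rewrite hom_gn // cl_twist.
  case Du: (D u); last by rewrite hom_gn // cl_twist Du.
  rewrite (morphJ (homM h2)) hom_gn // cl_twist Du.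
  have -> : hom e (twist D tau (~~ c)) (letter e (tau u, ~~ c)) = letter e (tau u, ~~ c).
    have E : hom e (twist D tau (~~ c)) (gn e (tau u)) = gn e (tau u).
      by rewrite hom_gn // cl_twist (negbTE (tauD Du)).
    rewrite /letter /=; move: (~~ c) h2 E => d h2 E.
    by case: d h2 E => h2 E; rewrite ?(morphV (homM h2)) E.
  by rewrite letterN conjgKV.
apply/inverse_endoP; first exact: twist_endo.
split; [exact: twist_endo | exact: canc |].
by have := canc (~~ b); rewrite negbK.
Qed.

Lemma twist_aut b : is_aut e (twist D tau b).
Proof. by split; [apply: twist_endo | exists (twist D tau (~~ b)); apply: twist_inverse]. Qed.
End Twist.

Section Inner.
Variables (V : finType) (e : rel V).

Definition inner_word (v : V) (b : bool) : V -> word V :=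
  fun u => [:: (v, b); (u, false); (v, ~~ b)].

Lemma cl_inner v b u : cl e (inner_word v b u) = gn e u ^ letter e (v, ~~ b).
Proof. by rewrite !cl_cons cl_nil mulg1 conjgE letterN invgK. Qed.

Lemma inner_endo v b : is_endo e (inner_word v b).
Proof.
apply/is_endoP => u w uw; rewrite !cl_inner.
by rewrite /commute -!conjMg (gn_commute uw).
Qed.

Lemma hom_inner v b x : hom e (inner_word v b) x = x ^ letter e (v, ~~ b).
Proof.
move: x; apply: morph_ext; first exact/homM/inner_endo.
  by move=> x y; rewrite conjMg.
by move=> u; rewrite hom_gn ?cl_inner //; apply: inner_endo.
Qed.

Lemma inner_aut v b : is_aut e (inner_word v b).
Proof.
split; first exact: inner_endo.
exists (inner_word v (~~ b)); apply/inverse_endoP; first exact: inner_endo.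
split; first exact: inner_endo.
  by move=> x; rewrite !hom_inner negbK letterN conjgKV.
by move=> x; rewrite !hom_inner negbK letterN conjgK.
Qed.
End Inner.

(** * Closure properties of liftability *)

Section Liftable.
Variables (W V : finType) (eL : rel W) (eG : rel V) (phi : W -> V).
Hypothesis phiE : forall u u', eL u u' -> eG (phi u) (phi u').
Local Notation Phi := (raag_map eL eG phi).

Lemma liftableP f : is_endo eG f -> liftable eL eG phi f <->
  exists2 F, is_aut eL F & forall y, Phi (hom eL F y) = hom eG f (Phi y).
Proof.
move=> hf; split=> [[F [aF h]]|[F aF h]]; exists F; last split=> //.
- by [].
- have hF := aF.1.
  have M1 : {morph (fun y => Phi (hom eL F y)) : x y / x * y}.
    by move=> x y; rewrite homM // raag_mapM.
  have M2 : {morph (fun y => hom eG f (Phi y)) : x y / x * y}.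
    by move=> x y; rewrite raag_mapM // homM.
  apply: (morph_ext M1 M2) => u; rewrite hom_gn // raag_map_gn // hom_gn //.
  by rewrite raag_map_cl //; apply/esym/clP.
- move=> u; apply/clP; rewrite -(raag_map_cl phiE) -(hom_gn _ aF.1) h.
  by rewrite raag_map_gn // hom_gn.
Qed.

Lemma liftable_comp f g : is_endo eG f -> is_endo eG g ->
  liftable eL eG phi f -> liftable eL eG phi g -> liftable eL eG phi (comp f g).
Proof.
move=> hf hg /(liftableP hf) [F aF hF] /(liftableP hg) [H aH hH].
apply/liftableP; first exact: is_endo_comp.
exists (comp F H); first exact: is_aut_comp.
by move=> y; rewrite (hom_comp hf hg) (hom_comp aF.1 aH.1) /= hF hH.
Qed.

Lemma liftable_inv f g : is_endo eG f -> inverse_endo eG f g ->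
  liftable eL eG phi f -> liftable eL eG phi g.
Proof.
move=> hf /(inverse_endoP _ hf) [hg K1 K2] /(liftableP hf) [F aF hF].
have [hF0 [H inv]] := aF; have [hH K3 K4] := (inverse_endoP _ hF0).1 inv.
apply/liftableP => //; exists H.
  by split=> //; exists F; apply: inverse_endo_sym.
by move=> y; apply: (can_inj K1); rewrite -hF K2 K4.
Qed.

Lemma liftable_eq f g : endo_eq eG f g -> liftable eL eG phi f -> liftable eL eG phi g.
Proof.
move=> E [F [aF h]]; exists F; split=> // u.
exact: req_trans (req_sym (E _)) (h u).
Qed.

Lemma liftable_inner vt b : liftable eL eG phi (inner_word (phi vt) b).
Proof.
exists (inner_word vt b); split; first exact: inner_aut.
by move=> u; apply: req_refl.
Qed.
End Liftable.

(** * Shortening *)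

Section PartialConj.
Variables (V : finType) (e : rel V).
Hypothesis symE : symmetric e.

(** At [false] this is [partial_conj v C] up to conversion; at [true] it is the inverse when [C] is
    a union of components. *)
Definition pconj (v : V) (C : {set V}) : bool -> V -> word V :=
  twist (fun w => w \in C) (fun=> v).

Variables (v : V) (C : {set V}).
Hypothesis compC : union_comp_compl_star e v C.

Let pconjD u : u \in C -> v \notin C.
Proof. by move=> _; apply: contraL isT => /compC.1; rewrite /in_star eqxx. Qed.

Let pconjE u u' : u \in C -> e u u' -> if u' \in C then v = v else in_star e v u'.
Proof.
move=> uC uu'; case: ifP => // /negbT nC; apply: contraR nC => nst.
exact: compC.2 uC nst uu'.
Qed.

Lemma pconj_aut b : is_aut e (pconj v C b).
Proof. exact: (@twist_aut _ _ symE (fun w => w \in C) (fun=> v) pconjD pconjE b). Qed.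

Lemma pconj_inverse b : inverse_endo e (pconj v C b) (pconj v C (~~ b)).
Proof. exact: (@twist_inverse _ _ symE (fun w => w \in C) (fun=> v) pconjD pconjE b). Qed.
End PartialConj.

Section Shortening.
Variables (V : finType) (e : rel V).
Hypothesis symE : symmetric e.

Definition has_sign (b : bool) (n : int) : bool := if b then (n < 0)%R else (0 < n)%R.

Lemma kappa_sign_crossing b a w : has_sign b (kappa a (cl e w)) ->
  exists c, [/\ c \in crossings e w, axis c = a & c.2 = b].
Proof.
rewrite /kappa kap_cl //; elim: (crossings e w) => [|c r IH]; first by rewrite big_nil; case: b.
have IH' : has_sign b (\sum_(d <- r | axis d == a) sgn d.2)%R ->
    exists d, [/\ d \in c :: r, axis d = a & d.2 = b].
  by case/IH => d [dr da db]; exists d; rewrite inE dr orbT.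
rewrite big_cons /= -/(axis c); move: IH'; set S := (\sum_(d <- r | _) _)%R => IH'.
case: (axis c =P a) => [ca|_] //.
case: (c.2 =P b) => [cb _|]; first by exists c; rewrite mem_head.
move=> ne h; apply: IH'; move: ne h; rewrite /has_sign /sgn.
clearbody S; case: (c.2); case: (b) => //; lia.
Qed.

(** The crossed letter, conjugated by the prefix before it, is [f (letter e (v, c.2))]; deleting it
    therefore divides by this element on the left. *)
Lemma cancel_crossing (f : raag e -> raag e) v w c : {morph f : x y / x * y} ->
  c \in crossings e w -> axis c = f (gn e v) ->
  exists2 w', size w' < size w & cl e w' = (f (letter e (v, c.2)))^-1 * cl e w.
Proof.
move=> fM cw E; have [w1 [w2 [Ew ax]]] := crossingP cw.
exists (w1 ++ w2); first by rewrite Ew !size_cat /= addnS.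
have -> : f (letter e (v, c.2)) = letter e (c.1.1, c.2) ^ (cl e w1)^-1.
  by rewrite /letter /=; case: (c.2); rewrite ?(morphV fM) -E ax // conjVg.
rewrite [in RHS]Ew !cl_cat cl_cons -conjVg conjgE invgK -!mulgA.
by rewrite mulKg mulKg.
Qed.
End Shortening.

(** * Liftable shortenings and the descent *)

Section Main.
Variables (W V : finType) (eL : rel W) (eG : rel V) (phi : W -> V).
Hypotheses (gL : simple_graph eL) (gG : simple_graph eG).
Hypothesis reg : regular_covering eL eG phi.
Let symL := gL.1.
Let irrL := gL.2.
Let symG := gG.1.
Let irrG := gG.2.
Let phiE := cover_edge reg.

Lemma isolating_liftable v C tau b : union_comp_compl_star eG v C ->
  isolating eL phi v C tau -> liftable eL eG phi (pconj v C b).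
Proof.
move=> compC iso.
exists (twist (fun u => phi u \in C) tau b); split.
  apply: twist_aut => // [u uC|u u' uC uu'].
    rewrite (iso u uC).1; apply: contraL isT => /compC.1; rewrite /in_star eqxx //.
  have := (iso u uC).2 u' uu'; case: ifP => // _ h.
  by rewrite /in_star h orbT.
move=> u; rewrite /pconj /twist; case: ifP => uC; last exact: req_refl.
by rewrite /= (iso u uC).1; apply: req_refl.
Qed.

(** The partial conjugation of [C] is the inverse of that of the complementary [C'], followed by
    conjugation by [v], which lifts to conjugation by any [vt] above [v]. *)
Lemma coisolating_liftable v C C' tau :
  union_comp_compl_star eG v C -> union_comp_compl_star eG v C' ->
  (forall w, ~~ in_star eG v w -> (w \in C') = (w \notin C)) ->
  isolating eL phi v C' tau -> liftable eL eG phi (pconj v C false).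
Proof.
move=> compC compC' CC' iso.
have [vt vtE] : exists vt, phi vt = v by case: reg => [[h _] _].
have hP := (pconj_aut symG compC' true).1.
have lft : liftable eL eG phi (comp (inner_word v false) (pconj v C' true)).
  apply: liftable_comp => //; first exact: inner_endo.
    by rewrite -vtE; apply: liftable_inner.
  exact: isolating_liftable iso.
apply: liftable_eq lft => w; apply/clP; rewrite cl_comp; last exact: inner_endo.
rewrite hom_inner !cl_twist; have [st|nst] := boolP (in_star eG v w).
  have -> : w \in C' = false by apply: contraTF st => /compC'.1.
  have -> : w \in C = false by apply: contraTF st => /compC.1.
  by rewrite gn_conj_letter.
by rewrite CC' //; case: (w \in C); rewrite /letter //= conjgK.
Qed.

Section Step.
Variables (f : V -> word V) (k : V -> word V).
Hypotheses (autf : is_aut eG f) (lf : liftable eL eG phi f).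
Hypothesis fk : forall v, hom eG f (gn eG v) = gn eG v ^ (cl eG (k v))^-1.

Let p v w := kappa (hom eG f (gn eG v)) (cl eG (k w)).

Lemma aut_inj : injective (hom eG f).
Proof. by case: autf => hf [g /(inverse_endoP _ hf) [_ /can_inj]]. Qed.

Lemma aut_surj y : exists x, hom eG f x = y.
Proof. by case: autf => hf [g /(inverse_endoP _ hf) [_ _ K]]; exists (hom eG g y). Qed.

Lemma p_connect v u u' : ~~ in_star eG v (phi u) -> ~~ in_star eG v (phi u') ->
  (forall vt, phi vt = v -> connect (away eL vt) u u') -> p v (phi u) = p v (phi u').
Proof.
have hf := autf.1; have [F [hF [Fi inv]] PhiF] := (liftableP phiE hf).1 lf.
have [_ FK FiK] := (inverse_endoP _ hF).1 inv.
exact: (@kappa_conj_connect _ _ _ _ _ symL irrL symG phiE _ _ _ (cl eG \o k)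
  (homM hF) FK FiK (homM hf) aut_inj fk PhiF).
Qed.

(** The edge lifts to one off the stars of all lifts of [v], so [p_connect] applies. *)
Lemma p_edge v w w' : eG w w' -> ~~ in_star eG v w -> ~~ in_star eG v w' -> p v w = p v w'.
Proof.
move=> ww' nw nw'; have [u uE] : exists u, phi u = w by case: reg => [[h _] _].
have [u' uu' u'E] : exists2 u', eL u u' & phi u' = w'.
  by apply: (cover_lift reg); rewrite uE.
rewrite -uE -u'E; apply: p_connect; rewrite ?uE ?u'E // => vt vtv.
have off z : ~~ in_star eG v (phi z) -> ~~ in_star eL vt z.
  apply: contra; rewrite /in_star -vtv.
  by case/orP => [/eqP ->|/phiE ->]; rewrite ?eqxx ?orbT.
by apply: connect1; rewrite /= uu' !off ?uE ?u'E.
Qed.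

Definition sign_set v b := [set w | ~~ in_star eG v w && has_sign b (p v w)].
Definition cosign_set v b := [set w | ~~ in_star eG v w && ~~ has_sign b (p v w)].

Lemma sign_set_comp v b : union_comp_compl_star eG v (sign_set v b).
Proof.
split=> [w|w w']; rewrite !inE; first by case/andP.
by move=> /andP [nw sw] nw' ww'; rewrite nw' -(p_edge ww').
Qed.

Lemma cosign_set_comp v b : union_comp_compl_star eG v (cosign_set v b).
Proof.
split=> [w|w w']; rewrite !inE; first by case/andP.
by move=> /andP [nw sw] nw' ww'; rewrite nw' -(p_edge ww').
Qed.

Lemma sign_set_liftable v b : liftable eL eG phi (pconj v (sign_set v b) false).
Proof.
have compC := sign_set_comp v b; have compC' := cosign_set_comp v b.
have [||] := isolating_dichotomy symL symG irrG reg compC compC'.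
- move=> u u'; rewrite !inE => /andP [nu su] /andP [nu' su'] con.
  by rewrite (p_connect nu nu' con) (negbTE su') in su.
- by case=> tau; apply: isolating_liftable.
- case=> tau; apply: coisolating_liftable => // w nst.
  by rewrite !inE nst.
Qed.
End Step.

(** Take for [C] all vertices where the count has the sign it has at [w]: each of their conjugators
    crosses the axis [f (gn eG v)] with that sign and loses a letter. *)
Lemma conjugating_shorten f k v w :
  is_aut eG f -> liftable eL eG phi f ->
  (forall v, hom eG f (gn eG v) = gn eG v ^ (cl eG (k v))^-1) ->
  ~~ in_star eG v w -> kappa (hom eG f (gn eG v)) (cl eG (k w)) != 0%R ->
  exists C b k', [/\ union_comp_compl_star eG v C, liftable eL eG phi (pconj v C false),
    forall u, hom eG (comp f (pconj v C (~~ b))) (gn eG u) = gn eG u ^ (cl eG (k' u))^-1 &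
    \sum_u size (k' u) < \sum_u size (k u)].
Proof.
move=> autf lf fk nvw nz; have hf := autf.1.
set n := kappa _ _ in nz; pose b := (n < 0)%R.
have wC : w \in sign_set f k v b.
  by rewrite inE nvw /= -/n /has_sign /b; case: ifP; lia.
have compC := sign_set_comp autf lf fk v b.
set C := sign_set f k v b in wC compC.
have hP := (pconj_aut symG compC (~~ b)).1.
have hfP := is_endo_comp hf hP.
(* The summand [(u \in C)] records the deleted letter; at [w] it makes the total drop strictly. *)
have short u : exists w' : word V,
    hom eG (comp f (pconj v C (~~ b))) (gn eG u) = gn eG u ^ (cl eG w')^-1 /\
    size w' + (u \in C) <= size (k u).
  rewrite hom_gn // cl_comp // cl_twist negbK; case: ifP => uC; last first.
    by exists (k u); rewrite addn0.
  have [c [cw ax cb]] : exists c,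
      [/\ c \in crossings eG (k u), axis c = hom eG f (gn eG v) & c.2 = b].
    by apply: kappa_sign_crossing => //; move: uC; rewrite inE => /andP [].
  have [w' sw w'E] := cancel_crossing (homM hf) cw ax.
  exists w'; rewrite addn1; split=> //.
  by rewrite (morphJ (homM hf)) fk w'E invgM invgK conjgM cb.
have [k' Hk'] := fin_all_exists short.
exists C, b, k'; split=> //.
- exact: sign_set_liftable.
- by move=> u; case: (Hk' u).
- rewrite (bigD1 w) //= [ltnRHS](bigD1 w) //= -addSn; apply: leq_add.
    by have := (Hk' w).2; rewrite wC addn1.
  by apply: leq_sum => u _; apply: leq_trans (Hk' u).2; apply: leq_addr.
Qed.

Lemma conjugating_word f : is_endo eG f -> conjugating eG f ->
  exists k, forall v, hom eG f (gn eG v) = gn eG v ^ (cl eG (k v))^-1.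
Proof.
move=> hf cf; have [k Hk] := fin_all_exists cf.
exists k => v; rewrite hom_gn //; have /clP -> := Hk v.
by rewrite !cl_cat cl_inv conjgE invgK mulgA.
Qed.

(** Descent on the total length of the conjugators; when no shortening is left,
    [short_conjugating_id] makes [f] the identity. *)
Lemma generated_by_shortening n f k :
  is_aut eG f -> liftable eL eG phi f ->
  (forall v, hom eG f (gn eG v) = gn eG v ^ (cl eG (k v))^-1) ->
  \sum_v size (k v) < n ->
  generated eG (fun g => is_partial_conj eG g /\ liftable eL eG phi g) f.
Proof.
elim: n f k => [//|n IH] f k autf lf fk le; have hf := autf.1.
have [[v [w [nvw nz]]]|nex] := pselect (exists v w, ~~ in_star eG v w /\
    kappa (hom eG f (gn eG v)) (cl eG (k w)) != 0%R).
  have [C [b [k' [compC lP fk' lt_k']]]] := conjugating_shorten autf lf fk nvw nz.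
  have aP := pconj_aut symG compC; have iP := pconj_inverse symG compC.
  have genP c : generated eG
      (fun g => is_partial_conj eG g /\ liftable eL eG phi g) (pconj v C c).
    have gen0 : generated eG
        (fun g => is_partial_conj eG g /\ liftable eL eG phi g) (pconj v C false).
      by apply: gen_base; [split=> //; exists v, C | apply: aP].
    by case: c => //; apply: gen_inv gen0 (iP false).
  have lP' : liftable eL eG phi (pconj v C (~~ b)).
    case: (~~ b); last exact: lP.
    exact: (liftable_inv phiE (aP false).1 (iP false) lP).
  have af' := is_aut_comp autf (aP (~~ b)).
  have lf' := liftable_comp phiE hf (aP (~~ b)).1 lf lP'.
  have gf' := IH _ k' af' lf' fk' (leq_trans lt_k' le).
  (* Composing the shortened map with [pconj v C b] gives back [f]. *)
  apply: (gen_eq (gen_comp gf' (genP b)) hf).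
  move=> u; apply/clP; rewrite (cl_comp _ _ af'.1) (hom_comp hf (aP (~~ b)).1).
  have [_ K _] := (inverse_endoP _ (aP b).1).1 (iP b).
  by rewrite -(hom_gn _ (aP b).1) [LHS]/= K hom_gn.
apply: (gen_eq (gen_id _ _) hf) => s; apply/clP; rewrite -(hom_gn _ hf).
apply/esym; apply: (short_conjugating_id symG (homM hf) (aut_inj autf) (aut_surj autf) fk).
move=> v w nvw; apply/eqP; apply: contraT => nz; case: nex.
by exists v, w.
Qed.
End Main.

Theorem theorem5p4 (W V : finType) (eL : rel W) (eG : rel V) (phi : W -> V) :
  simple_graph eL -> simple_graph eG ->
  regular_covering eL eG phi ->
  no_isolated eG ->
  forall f : V -> word V, LPAut eL eG phi f ->
    generated eG (fun g => is_partial_conj eG g /\ liftable eL eG phi g) f.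
Proof.
move=> gL gG reg _ f [autf [cf lf]].
have [k fk] := conjugating_word autf.1 cf.
exact: (generated_by_shortening gL gG reg autf lf fk (ltnSn _)).
Qed.
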